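(* Let $n\ge 1$. The maps $\Phi : J_n \to \mathcal{G}_n$ and $\Psi : \mathcal{G}_n \to J_n$ defined in the context are inverse bijections between the set $J_n$ of Brauer diagrams of degree $n$ and the set $\mathcal{G}_n$ of overhang paths of degree $n$.
   Context: **Overhang paths.** Consider steps between integral points of the semi-infinite rectangle $R=\{(x,y)\in\mathbb{R}^2 : 0\le x\le 2n,\ y\ge 0\}$ of the forms (1) $(a,b)\to(a+1,b+1)$; (2) $(a,b)\to(a+1,b-1)$; (2') $(a,b)\to(a-1,b+1)$. An overhang path of degree $n$ is a sequence of steps of forms (1), (2), (2') from $(0,0)$ to $(2n,0)$, staying in $R$ and visiting no vertex more than once. $\mathcal{G}_n$ is the set of these. A Dyck path of degree $n$ is an overhang path of degree $n$ using only steps (1) and (2). The path $p\in\mathcal{G}_n$, together with the $x$-axis with the interval from $(0,0)$ to $(2n,0)$ removed, divides the plane into two regions; the intersections with $R$ are the upper region and the lower region of $p$ (the lower region is the one lying below the path, between it and the segment from $(0,0)$ to $(2n,0)$). Write $p\le q$ if the lower region of $p$ is contained in that of $q$. The lowest path is $p_0=1212\cdots12$. The lower region of $p$ is tiled by the half-diamonds (triangles) with vertices $(2k,0),(2k+1,1),(2k+2,0)$, $0\le k\le n-1$ (these tile the lower region of $p_0$), and by diamonds with vertices $(a-1,b),(a,b+1),(a+1,b),(a,b-1)$, $a+b$ odd, $b\ge1$. The root of $p$ is the unique maximal Dyck path $t$ with $t\le p$. An overhang path has exactly $n$ steps of form (1), one starting on each line $x+y=2k$, $0\le k\le n-1$,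 and is determined by the starting points of these steps. **Brauer diagrams.** A Brauer diagram of degree $n$ is a pair partition of $2n$ vertices arranged from left to right on a line; its parts are called arcs, and each arc has a left-hand end and a right-hand end. $J_n$ is the set of Brauer diagrams of degree $n$. A TL diagram is a Brauer diagram without crossing arcs (no two arcs $\{a,b\},\{c,d\}$ with $a<c<b<d$). **The tile map $\Psi:\mathcal{G}_n\to J_n$.** Let $p\in\mathcal{G}_n$. Decorate the tiles of the lower region of $p$ with strands joining midpoints of edges: in each half-diamond, a strand joins its two slanted edges; in each diamond in the lower region of the root of $p$, one strand joins the two upper edges (NW and NE) and one joins the two lower edges (SW and SE); in each diamond in the lower region of $p$ but not in that of its root, the strands cross, joining NW to SE and NE to SW. In the upper region strands are joined by vertical segments: for each $k\in\{0,\dots,2n-1\}$, the path $p$ has an odd number of edges whose midpoint has $x$-coordinate $k+\tfrac12$; listing them from top to bottom, the first is joined vertically to the boundary vertex number $k+1$ (on a horizontal line above the path, vertices numbered $1,\dots,2n$ from left to right), the second is joined to the third, the fourth to the fifth, and so on. $\Psi(p)$ is the Brauer diagram pairing two boundary vertices when they are joined by a strand. **Labels.** The right-standard labelling of a Brauer diagram numbers the arcs $1,\dots,n$ in the order of their right-hand ends, from right to left; the ends of arc $k$ are called $kL$ and $kR$. The left-standard labelling numbers the arcs $1,\dots,n$ in the order of their left-hand ends, from right to left. **The chain tree and $\Pi$.** For a collection $C$ of arcs (on a subset of the vertices) and an arc $i\in C$, the arc subdiagram $C^i$ is the collection of arcs of $C$ whose right-hand end lies strictly between the two ends of $i$. The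 right chain $ch(C)$ is the sequence $a_1,a_2,\dots$ of arcs of $C$ in which $a_1$ is the arc whose right-hand end is rightmost, and $a_m$ (if it exists) is the arc whose right-hand end is the first right-hand end of an arc of $C$ met on moving left from the left-hand end of $a_{m-1}$. The arcs of $C$ are the disjoint union of the arcs in $ch(C)$ and of the subdiagrams $C^a$, $a\in ch(C)$. The right chain tree $\tau_R(D)$ of $D\in J_n$ is the planar rooted tree with vertices the arcs of $D$ together with a root $\emptyset$, defined recursively: the children of $\emptyset$ are the arcs of $ch(D)$, arranged in chain order from right to left; and if $a$ is a chain arc of the current collection $C$ (starting with $C=D$), the children of $a$ are the arcs of $ch(C^a)$ in chain order from right to left, and one continues with $C^a$ as current collection. $\Pi(D)$ is the TL diagram of degree $n$ that is the geometric dual of $\tau_R(D)$: traverse the tree depth-first from the root, visiting children from right to left, and write vertices of the diagram from right to left, writing a right-hand end when a non-root tree vertex is first entered and the left-hand end of the same arc when that tree vertex is finally left. The arc of $\Pi(D)$ with right-standard label $i$ right-corresponds to the arc of $D$ with right-standard label $i$. The secondary label of an arc of $D$ is the left-standard label of the right-corresponding arc of $\Pi(D)$. **Right-agreement.** Two Brauer diagrams of degree $n$ right-agree up to a vertex $x$ if their restrictions to $x$ and the vertices to its right coincide as partial diagrams (arcs with both ends there are the same, and the vertices paired with a vertex to the left of $x$, regarded as singletons, are the same). They maximally right-agree up to $x$ if moreover they do not right-agree up to the vertex immediately to the left of $x$. **The map $\Phi:J_n\to\mathcal{G}_n$.** For a TL diagram $T$, let $\Phi^{TL}(T)$ be the Dyck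 path obtained by reading the vertices from left to right and writing a step (1) for each left-hand end and a step (2) for each right-hand end. Label the steps of form (1) of this path $1,\dots,n$ from right to left (so each gets the left-standard label of the corresponding arc of $T$). Given $D\in J_n$, let $E=D$, its arcs carrying their secondary labels. While $E\neq\Pi(D)$: let $x$ be the vertex up to which $E$ and $\Pi(D)$ maximally right-agree; the arcs lying entirely in the agreeing part have labels $\{1,\dots,r\}$ for some $r\ge 0$; let $X_r$ be the number of steps to the right that the left-hand end of the arc labelled $r+1$ in $E$ must be moved in order to coincide with the left-hand end of the arc of $\Pi(D)$ with left-standard label $r+1$; replace $E$ by the diagram obtained by moving this left-hand end $X_r$ positions to the right (by adjacent transpositions, each vertex passed over shifting one place to the left), arcs keeping their labels. This process ends at $\Pi(D)$. Put $X_j=0$ for each $j\in\{0,\dots,n-1\}$ for which no move occurs. Then $\Phi(D)$ is the overhang path obtained from the Dyck path $\Phi^{TL}(\Pi(D))$ by appending, for each $i\in\{1,\dots,n\}$, to the step of form (1) labelled $i$ a left-overhanging stack of $X_{i-1}$ diamond tiles; i.e. if that step goes from $(a,b)$ to $(a+1,b+1)$, the corresponding step of form (1) of $\Phi(D)$ starts at $(a-X_{i-1},b+X_{i-1})$. *)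

(* Defs.v *)
From HB Require Import structures.
From mathcomp Require Import all_boot all_order all_algebra.
From mathcomp Require Import boolp.
From Stdlib Require Import Relation_Operators.

Set Implicit Arguments.
Unset Strict Implicit.
Unset Printing Implicit Defensive.

Import Order.TTheory GRing.Theory Num.Theory.

Local Open Scope nat_scope.

(** * Overhang paths *)

(* [Up], [Down], [Back] are the steps of forms (1), (2), (2'). *)
Inductive step := Up | Down | Back.

Definition step_comparable : comparable step.
Proof. by rewrite /comparable /decidable; decide equality. Defined.

HB.instance Definition _ := hasDecEq.Build step (compareP step_comparable).

Definition point : Type := (int * int)%type.

Definition step_vec (s : step) : point :=
  match s with
  | Up => (1, 1)%R
  | Down => (1, -1)%R
  | Back => (-1, 1)%R
  end.

Definition do_step (u : point) (s : step) : point := (u + step_vec s)%R.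

Definition origin : point := (0, 0)%R.

Definition vertices (p : seq step) : seq point :=
  origin :: scanl do_step origin p.

Definition in_rect (n : nat) (u : point) : bool :=
  ((0 <= u.1 <= Posz n.*2%N) && (0 <= u.2))%R.

Definition overhang (n : nat) (p : seq step) : bool :=
  [&& all (in_rect n) (vertices p), uniq (vertices p)
    & last origin (vertices p) == (Posz n.*2, 0%R)].

Definition dyck (n : nat) (t : seq step) : bool :=
  overhang n t && (Back \notin t).

(** * Lower regions *)

(* An edge of the lattice is represented by the double of its midpoint, that
   is, by the sum of its two end points. *)
Definition path_edges (p : seq step) : seq point :=
  pairmap +%R origin (scanl do_step origin p).

(* A tile is represented by its centre [(a, b)], with [a + b] odd.  For
   [b >= 1] it is the diamond with vertices [(a-1,b), (a,b+1), (a+1,b),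
   (a,b-1)]; for [b = 0] it is the half-diamond with vertices [(a-1,0),
   (a,1), (a+1,0)], whose slanted edges are [NW] and [NE]. *)
Definition NE (c : point) : point := (c + c + (1, 1))%R.
Definition NW (c : point) : point := (c + c + (-1, 1))%R.
Definition SE (c : point) : point := (c + c + (1, -1))%R.
Definition SW (c : point) : point := (c + c + (-1, -1))%R.

(* The curve formed by the path and the two outer parts of the x-axis runs
   along edges of the tiling of the upper half-plane, so a region of its
   complement is, in the half-plane, a union of tiles, and is closed under
   passing from a tile to a neighbour through an edge that is not on the path.
   The lower region is the one reached from the removed interval of the x-axis,
   hence the one containing the n half-diamonds standing on this interval.
   (Centres [c] and [d] of tiles with a common edge differ by [(+-1, +-1)], and
   [c + d] is the double of the midpoint of this edge.) *)
Inductive lower (n : nat) (p : seq step) : point -> Prop :=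
| lower_base (k : nat) : k < n -> lower n p (Posz k.*2.+1, 0%R)
| lower_cross (c d : point) :
    lower n p c ->
    d \in [:: c + (1, 1); c + (-1, 1); c + (1, -1); c + (-1, -1)]%R ->
    (0 <= d.2)%R ->
    (c + d)%R \notin path_edges p ->
    lower n p d.

Definition path_le (n : nat) (p q : seq step) : Prop :=
  forall c, lower n p c -> lower n q c.

Definition is_root (n : nat) (p t : seq step) : Prop :=
  [/\ dyck n t, path_le n t p &
      forall s, dyck n s -> path_le n s p -> path_le n t s -> s = t].

Definition lower_root (n : nat) (p : seq step) (c : point) : Prop :=
  exists2 t, is_root n p t & lower n t c.

(** * Brauer diagrams *)

(* The vertices are numbered from 0 to 2n-1, from left to right. *)
Definition brauer (n : nat) (D : {set {set 'I_(n.*2)}}) : bool :=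
  partition D [set: 'I_(n.*2)] && [forall A in D, #|A| == 2].

(** * The map [Psi] *)

Inductive node := Mid of point | Boundary of nat.

(* The edges of [p] over the interval [k, k+1], from top to bottom. *)
Definition column (p : seq step) (k : nat) : seq point :=
  sort (fun e f : point => (f.2 <= e.2)%R)
    [seq e <- path_edges p | e.1 == Posz k.*2.+1].

Inductive strand_piece (n : nat) (p : seq step) : node -> node -> Prop :=
| piece_half c : lower n p c -> c.2 = 0%R ->
    strand_piece n p (Mid (NW c)) (Mid (NE c))
| piece_root_upper c : lower_root n p c -> (1 <= c.2)%R ->
    strand_piece n p (Mid (NW c)) (Mid (NE c))
| piece_root_lower c : lower_root n p c -> (1 <= c.2)%R ->
    strand_piece n p (Mid (SW c)) (Mid (SE c))
| piece_cross_NW c : lower n p c -> ~ lower_root n p c -> (1 <= c.2)%R ->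
    strand_piece n p (Mid (NW c)) (Mid (SE c))
| piece_cross_NE c : lower n p c -> ~ lower_root n p c -> (1 <= c.2)%R ->
    strand_piece n p (Mid (NE c)) (Mid (SW c))
| piece_top k : k < n.*2 -> 0 < size (column p k) ->
    strand_piece n p (Boundary k) (Mid (nth origin (column p k) 0))
| piece_vertical k i : k < n.*2 -> i.*2.+2 < size (column p k) ->
    strand_piece n p (Mid (nth origin (column p k) i.*2.+1))
                     (Mid (nth origin (column p k) i.*2.+2)).

Definition strand (n : nat) (p : seq step) : node -> node -> Prop :=
  clos_refl_sym_trans node (strand_piece n p).

Definition Psi (n : nat) (p : seq step) : {set {set 'I_(n.*2)}} :=
  [set A : {set 'I_(n.*2)} | [exists k, exists l,
     [&& A == [set k; l], k != l
       & `[< strand n p (Boundary k) (Boundary l) >]]]].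

(** * Arcs and labels *)

(* An arc is the pair of its left-hand end and its right-hand end. *)
Definition darc : Type := (nat * nat)%type.

(* In these two lists, the arc labelled [i] has index [i - 1]. *)
Definition right_std (C : seq darc) : seq darc :=
  sort (fun a b : darc => b.2 <= a.2) C.
Definition left_std (C : seq darc) : seq darc :=
  sort (fun a b : darc => b.1 <= a.1) C.

Definition arcs (n : nat) (D : {set {set 'I_(n.*2)}}) : seq darc :=
  right_std [seq (val x.1, val x.2)
    | x <- enum [pred x : 'I_(n.*2) * 'I_(n.*2)
                | (x.1 < x.2) && ([set x.1; x.2] \in D)]].

(** * The right chain tree and [Pi] *)

(* From here to [Pi], a collection of arcs is listed in right-standard order,
   so that its first arc is the one with rightmost right-hand end. *)
Definition subdiagram (C : seq darc) (i : darc) : seq darc :=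
  [seq a <- C | i.1 < a.2 < i.2].

(* [m] bounds the recursion; so it does in [chain_forest_rec]. *)
Fixpoint right_chain_rec (m : nat) (C : seq darc) : seq darc :=
  match m, C with
  | m'.+1, a :: _ => a :: right_chain_rec m' [seq b <- C | b.2 < a.1]
  | _, _ => [::]
  end.

Definition right_chain (C : seq darc) : seq darc := right_chain_rec (size C) C.

(* The children of a vertex are listed from right to left. *)
Inductive tree := Node of darc & seq tree.

Fixpoint chain_forest_rec (m : nat) (C : seq darc) : seq tree :=
  if m is m'.+1 then
    [seq Node a (chain_forest_rec m' (subdiagram C a)) | a <- right_chain C]
  else [::].

(* The right chain tree, as the list of the subtrees at the children of its
   root. *)
Definition chain_forest (C : seq darc) : seq tree :=
  chain_forest_rec (size C) C.

(* [(a, true)] and [(a, false)] record that [a] is entered and finally left. *)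
Fixpoint traverse (t : tree) : seq (darc * bool) :=
  let: Node a ts := t in
  (a, true) :: rcons (flatten [seq traverse u | u <- ts]) (a, false).

(* The [i]-th vertex to be written, counting from 0, is the vertex number
   [size w - 1 - i]. *)
Definition Pi (C : seq darc) : seq darc :=
  let w := flatten [seq traverse t | t <- chain_forest C] in
  let vertex e := (size w).-1 - index e w in
  right_std [seq (vertex (a, false), vertex (a, true)) | a <- C].

Definition right_corresponding (C : seq darc) (a : darc) : darc :=
  nth (0, 0) (Pi C) (index a C).

Definition secondary_label (C : seq darc) (a : darc) : nat :=
  (index (right_corresponding C a) (left_std (Pi C))).+1.

(** * Right-agreement *)

Definition right_agree (E F : seq darc) (x : nat) : bool :=
  perm_eq [seq a <- E | x <= a.1] [seq a <- F | x <= a.1] &&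
  perm_eq [seq a.2 | a <- E & a.1 < x <= a.2]
          [seq a.2 | a <- F & a.1 < x <= a.2].

Definition max_right_agree (E F : seq darc) (x : nat) : bool :=
  right_agree E F x && ~~ right_agree E F x.-1.

(** * The map [Phi] *)

(* The new position of vertex [v] when vertex [l] is moved [d] places to the
   right. *)
Definition shift_vertex (l d v : nat) : nat :=
  if v == l then l + d else if l < v <= l + d then v.-1 else v.

(* One round of the process with target [P].  In [P] and in the current diagram
   [E] the arc labelled [i] has index [i - 1]; [X] lists [X_0, ..., X_(n-1)]. *)
Definition process_step (n : nat) (P : seq darc) (st : seq darc * seq nat) :
    seq darc * seq nat :=
  let: (E, X) := st in
  if perm_eq E P then st else
  let x := find (max_right_agree E P) (iota 0 n.*2) in
  let r := count (fun a : darc => x <= a.1) E in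
  let l := (nth (0, 0) E r).1 in
  let d := (nth (0, 0) P r).1 - l in
  ([seq (shift_vertex l d a.1, shift_vertex l d a.2) | a <- E],
   set_nth 0 X r d).

(* A round makes the arc labelled [r + 1] part of the agreeing part, so [n]
   rounds complete the process. *)
Definition process (n : nat) (C : seq darc) : seq darc * seq nat :=
  let E := sort (fun a b => secondary_label C a <= secondary_label C b) C in
  iter n (process_step n (left_std (Pi C))) (E, nseq n 0).

Definition overhang_sizes (n : nat) (C : seq darc) : seq nat :=
  (process n C).2.

Definition PhiTL (n : nat) (T : seq darc) : seq step :=
  [seq if v \in [seq a.1 | a <- T] then Up else Down | v <- iota 0 n.*2].

(* The starting points of the steps of form (1), from left to right. *)
Definition up_starts (p : seq step) : seq point :=
  [seq us.1 | us <- zip (vertices p) p & us.2 == Up].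

(* The straight line between two points with the same [x + y]. *)
Definition antidiagonal (u v : point) : seq step :=
  if (v.2 <= u.2)%R then nseq `|u.2 - v.2|%N Down
  else nseq `|v.2 - u.2|%N Back.

(* The path from [u] to [z] whose steps of form (1) have starting points
   [starts]. *)
Fixpoint path_through (u : point) (starts : seq point) (z : point) :
    seq step :=
  if starts is v :: starts' then
    antidiagonal u v ++ Up :: path_through (do_step v Up) starts' z
  else antidiagonal u z.

(* [X] is reversed because steps of form (1) are labelled from right to left. *)
Definition Phi_arcs (n : nat) (C : seq darc) : seq step :=
  path_through origin
    [seq (ux.1.1 - Posz ux.2, ux.1.2 + Posz ux.2)%R
      | ux <- zip (up_starts (PhiTL n (Pi C))) (rev (overhang_sizes n C))]
    (Posz n.*2, 0%R).

Definition Phi (n : nat) (D : {set {set 'I_(n.*2)}}) : seq step :=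
  Phi_arcs n (arcs D).

(* Main.v *)
(* An overhang path is determined by the abscissas [x k] of the starting points
   of its steps of form (1), one on each line [x + y = 2k], and [x k <= 2k] is
   the only constraint.  Its lower region consists of the tiles of abscissa
   [> x k] on each strip [2k <= x + y <= 2k + 2], and its root has the code
   [b 0 = x 0], [b (k + 1) = max (x (k + 1)) (b k + 1)].
   Adding the strip [k] to a path truncated at the line [x + y = 2k] adds one
   strand, and following the tiles shows that it amounts to inserting into the
   diagram an arc whose ends come at the positions [x k] and [b k + 1].  So
   [Psi] of the path is the diagram obtained by these successive insertions.
   The same insertions with [x] replaced by [b] give a TL diagram.  It is [Pi]
   of the former one, because the arc inserted last is a leaf of the chain tree
   and is the first one to be left; and the process defining [Phi] undoes the
   moves [b k - x k] of the left-hand ends one by one, the last inserted arc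
   first.  Hence [Phi] recovers the code.  Finally every Brauer diagram is
   obtained by insertions: the last inserted arc is the one whose right-hand end
   comes immediately after the last left-hand end. *)

Require Import Defs.
From mathcomp Require Import all_boot all_order all_algebra.
From mathcomp Require Import boolp zify.
From Stdlib Require Import Relation_Operators.

Set Implicit Arguments.
Unset Strict Implicit.
Unset Printing Implicit Defensive.

Import Order.TTheory GRing.Theory Num.Theory.

Local Open Scope nat_scope.

(** The process moves left-hand ends and leaves the sequence [b] of the root fixed. For this reason
    [matching] takes [b] as a separate argument: the given diagram, all stages of the process and
    the target are diagrams over the same [b], and arcs are compared by their insertion number. Two
    facts make [b] the right bookkeeping. All left-hand ends of the first k arcs lie before [b k],
    so every vertex from [b k] on is the right-hand end of an open arc; and these open ends do not
    depend on how far left the left-hand ends are. Whatever is read from right to left, such as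
    right-standard labels or the chain tree, is therefore controlled by [b]. A left-hand end can be
    away from its root position only when [b (k + 1) = b k + 1]. This leaves no room for a closed
    arc to separate the new arc from the branch of open arcs, which is what keeps the new arc a leaf
    of this branch. Strands are given as an equivalence closure: connections are shown by exhibiting
    pieces, but that two strands are distinct needs an invariant. The recursive numbering [label]
    serves as both the invariant and the description of the arcs. *)

(** * Diagrams built by successive insertions of arcs *)

(* The position of the vertex [v] after the insertion of two new vertices, which
   get the positions [a] and [b + 1]. *)
Definition spread (a b v : nat) : nat := v + (a <= v) + (b <= v).

(** Inverse of [spread a b] away from the two new positions [a] and [b + 1], where its values carry
    no meaning. *)
Definition gather (a b v : nat) : nat := v - (a < v) - (b.+1 < v).

Lemma gatherK a b v : a <= b -> v != a -> v != b.+1 ->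
  spread a b (gather a b v) = v.
Proof. by rewrite /spread /gather; lia. Qed.

Lemma ltn_spread a b u v : (spread a b u < spread a b v) = (u < v).
Proof. by rewrite /spread; lia. Qed.

Lemma spread_inj a b : injective (spread a b).
Proof. by rewrite /spread => u v; lia. Qed.

Lemma spread_neql a b v : a <= b -> spread a b v != a.
Proof. by rewrite /spread; lia. Qed.

Lemma spread_neqr a b v : a <= b -> spread a b v != b.+1.
Proof. by rewrite /spread; lia. Qed.

Definition spread_arc (a b : nat) (c : darc) : darc :=
  (spread a b c.1, spread a b c.2).

Lemma spread_arc_inj a b : injective (spread_arc a b).
Proof. by move=> [c d] [c' d'] [/spread_inj-> /spread_inj->]. Qed.

(* The arcs are listed in the order of insertion. *)
Fixpoint matching (x b : nat -> nat) (k : nat) : seq darc :=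
  if k is k'.+1 then
    rcons [seq spread_arc (x k') (b k') c | c <- matching x b k']
          (x k', (b k').+1)
  else [::].

(** The bound by [2k] makes [b k] a legal insertion position among the [2k] vertices already
    present. For the last index the third clause bounds [b n], which is compared with the left-hand
    ends of all n arcs. *)
Definition admissible (x b : nat -> nat) (n : nat) : Prop :=
  forall k, k < n -> [/\ x k <= b k, b k <= k.*2 & b k < b k.+1].

Lemma admissibleW x b n m : m <= n -> admissible x b n -> admissible x b m.
Proof. by move=> mn adm k km; apply: adm; apply: leq_trans km mn. Qed.

Definition ends (M : seq darc) : seq nat :=
  [seq c.1 | c <- M] ++ [seq c.2 | c <- M].

Definition is_matching (n : nat) (M : seq darc) : Prop :=
  perm_eq (ends M) (iota 0 n.*2) /\ {in M, forall c : darc, c.1 < c.2}.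

Lemma perm_spread_iota a b k : a <= b -> b <= k.*2 ->
  perm_eq (a :: b.+1 :: [seq spread a b v | v <- iota 0 k.*2])
          (iota 0 k.*2.+2).
Proof.
move=> ab bk; apply: uniq_perm; last 1 first.
- move=> v; rewrite !inE mem_iota /=; apply/idP/idP.
    case/or3P=> [/eqP->|/eqP->|/mapP[u]]; rewrite ?mem_iota; [lia|lia|].
    by move=> uk ->; rewrite /spread; lia.
  move=> vk; have [//|/= va] := eqVneq v a; have [//|/= vb] := eqVneq v b.+1.
  apply/mapP; exists (gather a b v); last by rewrite gatherK.
  by rewrite mem_iota /gather; lia.
- rewrite /= inE negb_or (map_inj_uniq (@spread_inj a b)) iota_uniq andbT.
  rewrite -andbA; apply/and3P; split; first by lia.
    by apply/mapP=> -[v _]; have := @spread_neql a b v ab; lia.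
  by apply/mapP=> -[v _]; have := @spread_neqr a b v ab; lia.
- exact: iota_uniq.
Qed.

Lemma ends_map (f : nat -> nat) M :
  ends [seq (f c.1, f c.2) | c <- M] = [seq f v | v <- ends M].
Proof. by rewrite /ends map_cat -!map_comp. Qed.

Lemma perm_ends M N : perm_eq M N -> perm_eq (ends M) (ends N).
Proof. by move=> MN; rewrite perm_cat // perm_map. Qed.

Lemma ends_cons c M : perm_eq (ends (c :: M)) (c.1 :: c.2 :: ends M).
Proof.
rewrite /ends /= perm_cons -[X in perm_eq _ X]cat1s perm_sym.
by rewrite perm_catCA.
Qed.

Lemma is_matching_perm n M N : perm_eq M N -> is_matching n M ->
  is_matching n N.
Proof.
move=> MN [pM lM]; split; last by move=> c; rewrite -(perm_mem MN); apply: lM.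
by apply: perm_trans pM; rewrite perm_sym perm_ends.
Qed.

Lemma size_ends M : size (ends M) = (size M).*2.
Proof. by rewrite size_cat !size_map addnn. Qed.

Lemma matching_size n M : is_matching n M -> size M = n.
Proof.
by case=> /perm_size; rewrite size_ends size_iota => /double_inj.
Qed.

Lemma mem_ends_iota n M v : is_matching n M -> (v \in ends M) = (v < n.*2).
Proof. by case=> /perm_mem-> _; rewrite mem_iota. Qed.

Lemma matching_uniq_ends n M : is_matching n M -> uniq (ends M).
Proof. by case=> /perm_uniq->; rewrite iota_uniq. Qed.

Lemma is_matching_uniq n M : is_matching n M -> uniq M.
Proof.
move=> /matching_uniq_ends; rewrite cat_uniq => /andP[/map_uniq //].
Qed.

Lemma mem_fst (M : seq darc) (c : darc) : c \in M -> c.1 \in ends M.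
Proof. by move=> cM; rewrite mem_cat map_f. Qed.

Lemma mem_snd (M : seq darc) (c : darc) : c \in M -> c.2 \in ends M.
Proof. by move=> cM; rewrite mem_cat map_f ?orbT. Qed.

Lemma matching_fst_inj n M : is_matching n M ->
  {in M &, injective (fun c : darc => c.1)}.
Proof.
move=> mM; have : uniq [seq c.1 | c <- M].
  by have := matching_uniq_ends mM; rewrite cat_uniq => /andP[].
elim: M {mM} => [|d M IH] //= /andP[dM uM] c c'; rewrite !inE.
case/predU1P=> [->|cM] /predU1P[->|cM'] //= e.
- by move: dM; rewrite e map_f.
- by move: dM; rewrite -e map_f.
- exact: IH.
Qed.

Lemma matching_snd_inj n M : is_matching n M ->
  {in M &, injective (fun c : darc => c.2)}.
Proof.
move=> mM; have : uniq [seq c.2 | c <- M].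
  by have := matching_uniq_ends mM; rewrite cat_uniq => /and3P[].
elim: M {mM} => [|d M IH] //= /andP[dM uM] c c'; rewrite !inE.
case/predU1P=> [->|cM] /predU1P[->|cM'] //= e.
- by move: dM; rewrite e map_f.
- by move: dM; rewrite -e map_f.
- exact: IH.
Qed.

Lemma matching_fst_neq_snd n M (c d : darc) :
  is_matching n M -> c \in M -> d \in M -> c.1 != d.2.
Proof.
move=> mM cM dM; have := matching_uniq_ends mM; rewrite cat_uniq.
case/and3P=> _ /hasPn/(_ d.2) h _; apply/eqP=> e.
by have := h (map_f _ dM); rewrite -e /= (map_f (fun c : darc => c.1)).
Qed.

Lemma is_matching_rcons n M a b : is_matching n M -> a <= b -> b <= n.*2 ->
  is_matching n.+1 (rcons [seq spread_arc a b c | c <- M] (a, b.+1)).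
Proof.
move=> [pM lM] ab bn.
apply: (@is_matching_perm _ ((a, b.+1) :: [seq spread_arc a b c | c <- M])).
  by rewrite perm_sym perm_rcons.
split; last first.
  move=> c; rewrite inE => /predU1P[->|/mapP[d /lM dd ->]] /=; first by lia.
  by rewrite ltn_spread.
apply: perm_trans (ends_cons _ _) _.
apply: perm_trans (perm_spread_iota ab bn); rewrite !perm_cons.
by rewrite ends_map perm_map.
Qed.

Lemma matchingP x b n : admissible x b n -> is_matching n (matching x b n).
Proof.
elim: n => [|n IH] adm /=; first by split.
have [xb bn _] := adm n (ltnSn n).
by apply: is_matching_rcons => //; apply/IH/(admissibleW _ adm).
Qed.

Lemma size_matching x b n : size (matching x b n) = n.
Proof. by elim: n => //= n IH; rewrite size_rcons size_map IH. Qed.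

Lemma eq_matching x x' b n : (forall k, k < n -> x k = x' k) ->
  matching x b n = matching x' b n.
Proof.
elim: n => //= n IH h; rewrite h // IH // => k kn.
by apply: h; apply: leq_trans kn _.
Qed.

Definition arc_at (M : seq darc) (i : nat) : darc := nth (0, 0) M i.

Lemma arc_at_rcons x b n i : i < n.+1 ->
  arc_at (matching x b n.+1) i =
  if i == n then (x n, (b n).+1)
  else spread_arc (x n) (b n) (arc_at (matching x b n) i).
Proof.
move=> ilt; rewrite /arc_at /= nth_rcons size_map size_matching.
case: (ltngtP i n) => // h; last by lia.
by rewrite (nth_map (0, 0)) ?size_matching.
Qed.

Lemma arc_atP x b n (c : darc) :
  reflect (exists2 i, i < n & c = arc_at (matching x b n) i)
          (c \in matching x b n).
Proof.
apply: (iffP (nthP (0, 0))); rewrite size_matching.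
  by move=> [i iN <-]; exists i.
by move=> [i iN ->]; exists i.
Qed.

Lemma mem_arc_at x b n i : i < n ->
  arc_at (matching x b n) i \in matching x b n.
Proof. by move=> iN; apply/arc_atP; exists i. Qed.

(** An older left-hand end lies before the insertion position [b n] of the right-hand end, so the
    new vertices push it by at most one place; the strict increase of [b] absorbs this place. *)
Lemma arc_at_fst_lt x b n i : admissible x b n -> i < n ->
  (arc_at (matching x b n) i).1 < b n.
Proof.
elim: n i => // n IH i adm ilt; have [xb _ bn] := adm n (ltnSn n).
rewrite arc_at_rcons //; case: eqP => [_|/eqP iN] /=; first by lia.
have := IH i (admissibleW (leqnSn n) adm) ltac:(lia).
by rewrite /spread; lia.
Qed.

(** When [x = b], each insertion takes place to the right of all older left-hand ends, which
    therefore never move again. *)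
Lemma root_arc_fst b n i : admissible b b n -> i < n ->
  (arc_at (matching b b n) i).1 = b i.
Proof.
elim: n i => // n IH i adm ilt; rewrite arc_at_rcons //.
case: eqP => [->|/eqP iN] //=.
have adm' := admissibleW (leqnSn n) adm.
have iN' : i < n by lia.
have := arc_at_fst_lt adm' iN'; rewrite IH // /spread; lia.
Qed.

(* The right-hand ends at or after the position [b n] are exactly the strands
   which are still open when the next arc is inserted; they do not depend on
   how far the left-hand ends have been moved. *)
Lemma arc_at_snd_open x b n i : admissible x b n -> i < n ->
  let r := (arc_at (matching x b n) i).2 in
  let r' := (arc_at (matching b b n) i).2 in
  (b n <= r) || (b n <= r') -> r = r'.
Proof.
elim: n i => // n IH i adm ilt; have [xb _ bn] := adm n (ltnSn n).
rewrite !arc_at_rcons //; case: eqP => [_|/eqP iN] //=.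
have := IH i (admissibleW (leqnSn n) adm) ltac:(lia) => /=.
by rewrite /spread; lia.
Qed.

(** Older right-hand ends undergo an increasing map, and the new one separates open arcs from closed
    arcs, which are the same in both diagrams by [arc_at_snd_open]. Hence arcs with the same
    insertion number have the same right-standard label. *)
Lemma arc_at_snd_mono x b n i j : admissible x b n -> i < n -> j < n ->
  ((arc_at (matching x b n) i).2 < (arc_at (matching x b n) j).2) =
  ((arc_at (matching b b n) i).2 < (arc_at (matching b b n) j).2).
Proof.
elim: n i j => // n IH i j adm ilt jlt; have [xb _ bn] := adm n (ltnSn n).
have adm' := admissibleW (leqnSn n) adm.
rewrite !arc_at_rcons //.
case: (eqVneq i n) => [ei|ni]; case: (eqVneq j n) => [ej|nj] /=.
- by rewrite !ltnn.
- have := @arc_at_snd_open x b n j adm' ltac:(lia) => /=.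
  by rewrite /spread; lia.
- have := @arc_at_snd_open x b n i adm' ltac:(lia) => /=.
  by rewrite /spread; lia.
- by rewrite !ltn_spread; apply: IH => //; lia.
Qed.

Fixpoint root_code (x : nat -> nat) (k : nat) : nat :=
  if k is k'.+1 then maxn (x k) (root_code x k').+1 else x 0.

Lemma root_code_ge x k : x k <= root_code x k.
Proof. by case: k => //= k; rewrite leq_maxl. Qed.

Lemma ltn_root_codeS x k : root_code x k < root_code x k.+1.
Proof. by rewrite /= leq_max ltnSn orbT. Qed.

Lemma root_code_le x n : (forall k, k <= n -> x k <= k.*2) ->
  forall k, k <= n -> root_code x k <= k.*2.
Proof.
by move=> xn; elim=> [|k IH] kn /=; [apply: xn | have := xn _ kn; lia].
Qed.

(* The value [x n = 2n] is the abscissa of the end point of the path. *)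
Definition code (n : nat) (x : nat -> nat) : Prop :=
  (forall k, k <= n -> x k <= k.*2) /\ x n = n.*2.

Lemma root_code_admissible n x z : code n x ->
  (forall k, k < n -> z k <= root_code x k) -> admissible z (root_code x) n.
Proof.
move=> [xn _] zb k kn; split; [exact: zb | | exact: ltn_root_codeS].
by apply: (root_code_le xn); lia.
Qed.

Lemma code_admissible n x : code n x -> admissible x (root_code x) n.
Proof. by move=> /root_code_admissible; apply=> k _; apply: root_code_ge. Qed.

Lemma root_admissible n x : code n x ->
  admissible (root_code x) (root_code x) n.
Proof. by move=> /root_code_admissible; apply. Qed.

(** Either the new arc starts at its root position, or the maximum in [root_code] comes from the
    previous value plus one, and the arc that starts at this previous value is pushed by exactly one
    place. *)
Lemma last_fst_matching n x : admissible x (root_code x) n.+1 ->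
  exists2 c : darc, c \in matching x (root_code x) n.+1 & c.1 = root_code x n.
Proof.
elim: n => [|n IH] adm; first by exists (x 0, (x 0).+1); rewrite ?mem_head.
have [xb _ _] := adm n.+1 (ltnSn _); have := xb.
rewrite leq_eqVlt => /predU1P[e|xb'].
  exists (x n.+1, (root_code x n.+1).+1) => //.
  by rewrite [matching _ _ _]/= mem_rcons mem_head.
have [|c cM c1] := IH; first exact: admissibleW adm.
exists (spread_arc (x n.+1) (root_code x n.+1) c).
  by rewrite [matching _ _ n.+2]/= mem_rcons inE map_f ?orbT.
by rewrite /= c1 /spread; move: xb' => /=; lia.
Qed.

Section SortEq.
Context (T : eqType) (leT : rel T).

Lemma sort_eq_in s s' : total leT -> transitive leT ->
  {in s &, antisymmetric leT} -> perm_eq s s' -> sorted leT s' ->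
  sort leT s = s'.
Proof.
move=> tot tr anti ss' srt.
apply: (@sorted_eq_in _ leT) => //; last by rewrite perm_sort.
- by move=> a b c _ _ _; apply: tr.
- by move=> a b; rewrite !mem_sort; apply: anti.
- exact: sort_sorted.
Qed.

End SortEq.

Lemma right_std_eq n M N : is_matching n M -> perm_eq M N ->
  sorted (fun a b : darc => b.2 <= a.2) N -> right_std M = N.
Proof.
move=> mM MN srt; apply: sort_eq_in => //.
- by move=> a b; apply: leq_total.
- by move=> b a c ab bc; apply: leq_trans bc ab.
- move=> a b aM bM; rewrite -eqn_leq => /eqP e.
  by apply: (matching_snd_inj mM).
Qed.

Lemma left_std_eq n M N : is_matching n M -> perm_eq M N ->
  sorted (fun a b : darc => b.1 <= a.1) N -> left_std M = N.
Proof.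
move=> mM MN srt; apply: sort_eq_in => //.
- by move=> a b; apply: leq_total.
- by move=> b a c ab bc; apply: leq_trans bc ab.
- move=> a b aM bM; rewrite -eqn_leq => /eqP e.
  by apply: (matching_fst_inj mM).
Qed.

Lemma right_std_sorted M : sorted (fun a b : darc => b.2 <= a.2) (right_std M).
Proof. by apply: sort_sorted => a b; apply: leq_total. Qed.

Lemma perm_right_std M : perm_eq (right_std M) M.
Proof. by rewrite perm_sort. Qed.

Lemma mem_right_std M : right_std M =i M.
Proof. by move=> c; rewrite mem_sort. Qed.

Lemma geq2_trans : transitive (fun a b : darc => b.2 <= a.2).
Proof. by move=> b a c ab bc; apply: leq_trans bc ab. Qed.

Lemma sorted_filter_threshold (s : seq darc) t :
  sorted (fun a b : darc => b.2 <= a.2) s ->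
  s = [seq c <- s | t <= c.2] ++ [seq c <- s | c.2 < t].
Proof.
elim: s => //= a s IH; rewrite (path_sortedE geq2_trans) => /andP[ale srt].
case: leqP => h /=; first by rewrite -IH.
rewrite (@eq_in_filter _ _ pred0) ?filter_pred0; last first.
  by move=> c /(allP ale) /= ca; lia.
rewrite /= (@eq_in_filter _ _ predT) ?filter_predT // => c /(allP ale) /= ca.
by lia.
Qed.

(** The open arcs, those ending at or after [b n], are pushed beyond the new right-hand end; the
    closed ones stay before it. So the new arc enters the list exactly at this threshold. *)
Lemma right_std_matchingS x b n : admissible x b n.+1 ->
  let R := right_std (matching x b n) in
  let s := spread_arc (x n) (b n) in
  right_std (matching x b n.+1) =
  [seq s c | c <- [seq c <- R | b n <= c.2]] ++
  (x n, (b n).+1) :: [seq s c | c <- [seq c <- R | c.2 < b n]].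
Proof.
move=> adm R s; have [xb _ _] := adm n (ltnSn n).
have srt := right_std_sorted (matching x b n).
apply: (right_std_eq (matchingP adm)).
  rewrite /= perm_rcons perm_sym -cat1s perm_catCA /= perm_cons.
  by rewrite -map_cat -sorted_filter_threshold // perm_map // perm_right_std.
rewrite (sorted_pairwise geq2_trans) pairwise_cat pairwise_cons.
have psrt : pairwise (fun a b : darc => b.2 <= a.2) R.
  by rewrite -(sorted_pairwise geq2_trans).
have ps P : pairwise (fun a b : darc => b.2 <= a.2)
    [seq s c | c <- [seq c <- R | P c]].
  rewrite pairwise_map; apply: sub_pairwise (pairwise_filter P psrt) => c d.
  by rewrite /= /spread; lia.
rewrite !ps !andbT; apply/andP; split.
  apply/allrelP=> c d /mapP[c' + ->] /=; rewrite mem_filter => /andP[h _].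
  rewrite inE => /predU1P[->|/mapP[d' + ->]] /=; first by rewrite /spread; lia.
  by rewrite mem_filter => /andP[h' _]; rewrite /spread; lia.
apply/allP=> d /mapP[d' + ->]; rewrite mem_filter => /andP[h' _] /=.
by rewrite /spread; lia.
Qed.

Lemma count_leq_iota m n : count (leq m) (iota 0 n) = n - m.
Proof.
elim: n => // n IH; rewrite -[in iota _ _]addn1 iotaD count_cat IH /= add0n.
by lia.
Qed.

Lemma count_gtn_iota m n : count (gtn m) (iota 0 n) = minn m n.
Proof.
elim: n => [|n IH]; first by rewrite minn0.
by rewrite -[in iota _ _]addn1 iotaD count_cat IH /= add0n; lia.
Qed.

(** With all left-hand ends before [b], each of the [2n - b] vertices from [b] on is a right-hand
    end. *)
Lemma size_open_arcs n M b :
  is_matching n M -> {in M, forall c : darc, c.1 < b} ->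
  size [seq c <- M | b <= c.2] = n.*2 - b.
Proof.
move=> [pM _] lt_b; have := permP pM (leq b); rewrite count_cat !count_map.
rewrite (@eq_in_count _ (preim _ _) pred0); last by move=> c /lt_b /=; lia.
by rewrite count_pred0 add0n size_filter => ->; rewrite count_leq_iota.
Qed.

(** * The chain tree *)

(** Fuel-free form of the depth-first traversal for a collection in right-standard order. The head
    [a] opens the chain; the arcs ending to the right of [a.1] form its subdiagram, because they end
    before [a.2], and the chain continues among those ending to the left of [a.1]. *)
Inductive traversal : seq darc -> seq (darc * bool) -> Prop :=
| traversal_nil : traversal [::] [::]
| traversal_cons a C w1 w2 :
    a.1 < a.2 -> all (fun c : darc => c.2 < a.2) C ->
    traversal [seq c <- C | a.1 < c.2] w1 ->
    traversal [seq c <- C | c.2 < a.1] w2 ->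
    traversal (a :: C) ((a, true) :: w1 ++ (a, false) :: w2).

Lemma right_chain_rec_sub m C : {subset right_chain_rec m C <= C}.
Proof.
elim: m C => [|m IH] [|a C] //= c; rewrite !inE => /predU1P[->|/IH].
  by rewrite eqxx.
rewrite -[if _ then _ else _]/([seq b <- a :: C | b.2 < a.1]) mem_filter.
by case/andP=> _; rewrite inE.
Qed.

Lemma right_chain_fuel C w m : traversal C w -> size C <= m ->
  right_chain_rec m C = right_chain C.
Proof.
move=> tC; elim: tC m => {C w} [|a C w1 w2 ltaa _ _ _ _ IH2] [|m] //= Cm.
rewrite /right_chain /= ltnNge (ltnW ltaa) /=.
have sz := leq_trans (eq_leq (size_filter _ C)) (count_size _ C).
by rewrite !IH2 // (leq_trans (sz _)).
Qed.

Lemma traversal_forest C w m : traversal C w -> size C <= m ->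
  flatten [seq traverse t | t <- chain_forest_rec m C] = w.
Proof.
move=> tC; elim: tC m => {C w} [|a C w1 w2 ltaa ltC t1 IH1 t2 IH2] [|m] //= Cm.
have sz := leq_trans (eq_leq (size_filter _ C)) (count_size _ C).
rewrite (_ : (a.2 < a.1) = false) ?(right_chain_fuel t2) ?sz //; last by lia.
rewrite ltnn andbF (_ : subdiagram C a = [seq c <- C | a.1 < c.2]); last first.
  by apply: eq_in_filter => c /(allP ltC) ->; rewrite andbT.
congr (_ :: _).
rewrite IH1 ?(leq_trans (sz _)) // cat_rcons; congr (_ ++ _ :: _).
rewrite -(IH2 m.+1) ?(leq_trans (sz _)) ?leqW //=.
congr (flatten [seq traverse t | t <- _]); apply/eq_in_map => c.
move=> /right_chain_rec_sub; rewrite mem_filter => /andP[ca cC].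
(* The subdiagram of [c] is taken in [a :: C] on one side and in the arcs left of [a.1] on the
   other. They agree because what ends inside [c] ends before [c.2 < a.1]. *)
congr (Node c (chain_forest_rec m _)).
rewrite (_ : _ && (a.2 < c.2) = false); last by have /= := allP ltC _ cC; lia.
rewrite /subdiagram -filter_predI; apply: eq_filter => d /=; lia.
Qed.

(* The new arc [k] becomes the leaf at the end of the branch formed by the arcs
   of [C1], so that it is the first one to be left. *)
Lemma traversal_insert C1 C2 k w :
  traversal (C1 ++ C2) w -> k.1 < k.2 ->
  {in C1, forall a : darc, k.2 < a.2} ->
  {in C1 & C1, forall a c : darc, a.1 < c.2} ->
  {in C1, forall a : darc, a.1 < k.2} ->
  {in C2, forall c : darc, c.2 < k.2} ->
  {in C2, forall c : darc, exists2 a : darc, a \in k :: C1 & c.2 < a.1} ->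
  exists2 w', w = [seq (a, true) | a <- C1] ++ w' &
    traversal (C1 ++ k :: C2)
      ([seq (a, true) | a <- C1] ++ [:: (k, true), (k, false) & w']).
Proof.
move=> + kk; elim: C1 C2 w => [|a C1 IH] C2 w /= tw kC1 C1C1 C1k C2k left.
  have {}left c : c \in C2 -> c.2 < k.1.
    by move=> /left[a]; rewrite inE => /eqP->.
  exists w => //; apply: (@traversal_cons _ _ [::]) => //.
  - by apply/allP.
  - rewrite (@eq_in_filter _ _ pred0) ?filter_pred0; first exact: traversal_nil.
    by move=> c /left /=; lia.
  - by rewrite (@eq_in_filter _ _ predT) ?filter_predT // => c /left.
inversion tw as [|? ? w1 w2 aa lta t1 t2]; subst.
have C1a : [seq c <- C1 | a.1 < c.2] = C1.
  rewrite (@eq_in_filter _ _ predT) ?filter_predT // => c cC1 /=.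
  by rewrite C1C1 ?mem_head // inE cC1 orbT.
have C1a' : [seq c <- C1 | c.2 < a.1] = [::].
  rewrite (@eq_in_filter _ _ pred0) ?filter_pred0 // => c cC1 /=.
  apply/negbTE; rewrite -leqNgt ltnW // C1C1 ?mem_head //.
  by rewrite inE cC1 orbT.
have ak : a.1 < k.2 by apply: C1k; apply: mem_head.
move: t1 t2; rewrite !filter_cat C1a C1a' cat0s => t1 t2.
have [|||||w' -> tw'] := IH _ _ t1.
- by move=> c cC1; apply: kC1; rewrite inE cC1 orbT.
- by move=> c d cC1 dC1; apply: C1C1; rewrite inE ?cC1 ?dC1 orbT.
- by move=> c cC1; apply: C1k; rewrite inE cC1 orbT.
- by move=> c; rewrite mem_filter => /andP[_]; apply: C2k.
- move=> c; rewrite mem_filter => /andP[ac /left[d]].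
  (* The witness cannot be [a] itself, as [c] ends to the right of [a.1]; so it survives in the
     smaller branch. *)
  rewrite !inE => /or3P[dk|/eqP->|dC1] cd; [exists d|lia|exists d] => //.
    by rewrite inE dk.
  by rewrite inE dC1 orbT.
exists (w' ++ (a, false) :: w2); first by rewrite catA.
rewrite -[_ :: w' ++ _]cat_cons -[_ :: (_ :: w') ++ _]cat_cons catA.
apply: traversal_cons => //.
- move: lta; rewrite !all_cat /= => /andP[-> ->]; rewrite andbT.
  by apply: kC1; apply: mem_head.
- by rewrite filter_cat /= ak C1a.
- by rewrite filter_cat /= C1a' ltnNge (ltnW ak).
Qed.

Definition spread_event (a b : nat) (e : darc * bool) : darc * bool :=
  (spread_arc a b e.1, e.2).

Lemma spread_event_inj a b : injective (spread_event a b).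
Proof.
move=> [c d] [c' d'] [/spread_inj e1 /spread_inj e2 ->].
by rewrite (surjective_pairing c) e1 e2 -surjective_pairing.
Qed.

Lemma traversal_spread a b C w : traversal C w ->
  traversal [seq spread_arc a b c | c <- C] [seq spread_event a b e | e <- w].
Proof.
elim=> {C w} [|c C w1 w2 cc ltC _ IH1 _ IH2] /=; first exact: traversal_nil.
rewrite map_cat /=; apply: traversal_cons => /=.
- by rewrite ltn_spread.
- by rewrite all_map; apply: sub_all ltC => d /=; rewrite ltn_spread.
- rewrite filter_map; rewrite (@eq_filter _ _ (fun d => c.1 < d.2)) //.
  by move=> d /=; rewrite ltn_spread.
- rewrite filter_map; rewrite (@eq_filter _ _ (fun d => d.2 < c.1)) //.
  by move=> d /=; rewrite ltn_spread.
Qed.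

Lemma arc_bounds x b n (c : darc) : admissible x b n -> c \in matching x b n ->
  [/\ c.1 < c.2, c.1 < b n & c.2 < n.*2].
Proof.
move=> adm cM; have mM := matchingP adm; split; first exact: mM.2.
  by case/arc_atP: cM => i iN ->; apply: arc_at_fst_lt.
by rewrite -(mem_ends_iota _ mM) mem_snd.
Qed.

(* An arc whose left-hand end has really been moved leaves no room between the
   last left-hand end and the right-hand ends of the open arcs. *)
Lemma closed_arc_left x n (c : darc) : admissible x (root_code x) n.+1 ->
  c \in matching x (root_code x) n -> c.2 < root_code x n ->
  c.2 < x n \/
  exists2 a : darc, a \in matching x (root_code x) n &
             c.2 < a.1 /\ root_code x n <= a.2.
Proof.
move=> adm cM cb; have [xb _ _] := adm n (ltnSn n).
have [e|nx] := eqVneq (x n) (root_code x n); first by left; rewrite e.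
right; case: n adm cM cb xb nx => [|n] adm cM cb xb nx.
  by rewrite eqxx in nx.
have adm' := admissibleW (leqnSn _) adm.
have [a aM a1] := last_fst_matching adm'; exists a => //.
have [aa _ _] := arc_bounds adm' aM.
have := matching_fst_neq_snd (matchingP adm') aM cM.
by move: cb nx xb => /=; lia.
Qed.

Lemma index_insert (T : eqType) (s t : seq T) (u v e : T) :
  e != u -> e != v ->
  index e (s ++ [:: u, v & t]) =
  if index e (s ++ t) < size s then index e (s ++ t)
  else (index e (s ++ t)).+2.
Proof.
move=> eu ev; rewrite !index_cat; case: ifP => es.
  by rewrite index_mem es.
by rewrite /= ![_ == e]eq_sym (negPf eu) (negPf ev) ltnNge leq_addr /=; lia.
Qed.

(** Vertices are written from right to left, so the event of index [i] is the vertex [2n - 1 - i].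
    One more insertion puts two consecutive events after the entries of the [2n - b n] open arcs,
    which means the vertices [b n + 1] and [b n]: this is the insertion step of [T], whatever [x n]
    is. *)
Lemma traversal_matching n x : admissible x (root_code x) n ->
  let M := matching x (root_code x) n in
  let T := matching (root_code x) (root_code x) n in
  exists w, [/\ traversal (right_std M) w, size w = n.*2 &
    forall i, i < n ->
      index (arc_at M i, true) w = n.*2.-1 - (arc_at T i).2 /\
      index (arc_at M i, false) w = n.*2.-1 - (arc_at T i).1].
Proof.
move=> + M T; rewrite {}/M {}/T.
elim: n => [|n IH] adm; first by exists [::]; split=> //; apply: traversal_nil.
set b := root_code x in adm IH *.
have [xb bn _] := adm n (ltnSn n).
have adm' := admissibleW (leqnSn _) adm.
have admb : admissible b b n by move=> k /adm'[_ ? ?].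
have mM := matchingP adm'; have mR := is_matching_perm _ mM.
have [w [tw szw iw]] := IH adm'; have eR := right_std_matchingS adm.
cbv zeta in eR; rewrite -/b in eR; move: eR.
set R := right_std (matching x b n) in tw *.
have RM c : (c \in R) = (c \in matching x b n) by rewrite mem_right_std.
set s := spread_arc (x n) (b n); set C1 := map s _; set C2 := map s _ => eR.
have tw' : traversal (C1 ++ C2) [seq spread_event (x n) (b n) e | e <- w].
  rewrite -map_cat -sorted_filter_threshold; last exact: right_std_sorted.
  exact: traversal_spread.
have C1P (c : darc) : c \in C1 ->
    exists d : darc, [/\ c = s d, d \in matching x b n & b n <= d.2].
  by case/mapP=> d; rewrite mem_filter RM => /andP[? ?] ->; exists d.
have C2P (c : darc) : c \in C2 ->
    exists d : darc, [/\ c = s d, d \in matching x b n & d.2 < b n].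
  by case/mapP=> d; rewrite mem_filter RM => /andP[? ?] ->; exists d.
have [||||||w' ew tw''] := @traversal_insert _ _ (x n, (b n).+1) _ tw'.
- by rewrite /=; lia.
- by move=> c /C1P[d [-> dM bd]]; rewrite /= /spread; lia.
- move=> c c' /C1P[d [-> dM bd]] /C1P[d' [-> dM' bd']].
  by have [_ ? _] := arc_bounds adm' dM; rewrite /= /spread; lia.
- move=> c /C1P[d [-> dM bd]].
  by have [_ ? _] := arc_bounds adm' dM; rewrite /= /spread; lia.
- by move=> c /C2P[d [-> dM bd]]; rewrite /= /spread; lia.
- move=> c /C2P[d [-> dM bd]].
  have [dx|[a aM [da ba]]] := closed_arc_left adm dM bd.
    by exists (x n, (b n).+1); rewrite ?mem_head //= /spread; lia.
  exists (s a); last by rewrite /= ltn_spread.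
  by rewrite inE map_f ?orbT // mem_filter ba RM.
have szC1 : size C1 = n.*2 - b n.
  rewrite size_map (@size_open_arcs n) //.
    by apply: mR; rewrite perm_sym perm_right_std.
  by move=> c; rewrite RM => /(arc_bounds adm')[].
have szw' : (size C1 + size w' = n.*2)%N.
  by have := congr1 size ew; rewrite size_cat !size_map szw.
exists ([seq (a, true) | a <- C1] ++
        [:: (x n, (b n).+1, true), (x n, (b n).+1, false) & w']).
split; [by rewrite -/b eR | by rewrite size_cat size_map /=; lia |].
have nA e (new : darc) : new = (x n, (b n).+1) ->
    (new, e) \notin [seq (a, true) | a <- C1].
  move=> ->; apply/mapP=> -[c /C1P[d [-> _ _]]] [+ _].
  by have := spread_neql d.1 xb; lia.
move=> i ilt; rewrite !arc_at_rcons //; case: eqP => [_|/eqP ni].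
  rewrite !index_cat !(negPf (nA _ _ erefl)) /= !eqxx size_map szC1.
  have -> : ((x n, (b n).+1, true) == (x n, (b n).+1, false)) = false.
    by apply/eqP=> -[].
  by lia.
have iN : i < n by lia.
have [iT iF] := iw i iN.
have [TT _ T2] := arc_bounds admb (mem_arc_at b b iN).
have neq e e' : (s (arc_at (matching x b n) i), e) != (x n, (b n).+1, e').
  apply/eqP=> -[+ _ _].
  by have := spread_neql (arc_at (matching x b n) i).1 xb; lia.
have old e : index (s (arc_at (matching x b n) i), e)
    [seq spread_event (x n) (b n) e | e <- w] =
    index (arc_at (matching x b n) i, e) w.
  exact: (index_map (@spread_event_inj (x n) (b n)) w (_, e)).
rewrite !index_insert ?neq // -ew !old iT iF size_map szC1 /= /spread.
move: TT T2; set p := arc_at _ _ => TT T2.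
split; case: ifP; lia.
Qed.

Lemma matching_mkseq x b n :
  matching x b n = mkseq (arc_at (matching x b n)) n.
Proof. by rewrite -[LHS](mkseq_nth (0, 0)) size_matching. Qed.

Lemma sorted_rev_matching x b n (r : rel darc) :
  (forall i j, i < j < n ->
     r (arc_at (matching x b n) j) (arc_at (matching x b n) i)) ->
  sorted r (rev (matching x b n)).
Proof.
move=> h; rewrite rev_sorted; apply/pairwise_sorted/(pairwiseP (0, 0)) => i j.
by rewrite !inE size_matching => iN jN ij; apply: h; rewrite ij.
Qed.

Lemma map_matching x x' b b' n (f : darc -> darc) :
  (forall i, i < n ->
     f (arc_at (matching x b n) i) = arc_at (matching x' b' n) i) ->
  [seq f c | c <- matching x b n] = matching x' b' n.
Proof.
move=> h; apply: (@eq_from_nth _ (0, 0)); rewrite size_map !size_matching //.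
by move=> i iN; rewrite (nth_map (0, 0)) ?size_matching //; apply: h.
Qed.

(** * The map [Pi] and the secondary labels in terms of insertion numbers *)

Section PiMatching.

Context (n : nat) (x : nat -> nat).
Hypothesis xn : code n x.
Let b := root_code x.
Let M := matching x b n.
Let T := matching b b n.
Let C := right_std M.

Let admx : admissible x b n. Proof. exact: code_admissible. Qed.
Let admb : admissible b b n. Proof. exact: root_admissible. Qed.
Let mM : is_matching n M. Proof. exact: matchingP. Qed.
Let mT : is_matching n T. Proof. exact: matchingP. Qed.

(** [f] reads an arc of the dual off the two events of an arc. It preserves the order of right-hand
    ends, so the final sorting in [Pi] changes nothing and [f] is the right-correspondence. *)
Lemma Pi_matching : exists2 f : darc -> darc,
  forall i, i < n -> f (arc_at M i) = arc_at T i & Pi C = [seq f c | c <- C].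
Proof.
have [w [tw szw iw]] := traversal_matching admx.
pose v e := (size w).-1 - index e w.
pose f (c : darc) : darc := (v (c, false), v (c, true)).
have fM i : i < n -> f (arc_at M i) = arc_at T i.
  move=> iN; have [iT iF] := iw i iN.
  have [T12 _ T2] := arc_bounds admb (mem_arc_at b b iN).
  rewrite /f /v iT iF szw -/b -/T in T12 T2 *.
  by case: (arc_at T i) T12 T2 => p q /= pq qn; congr (_, _); lia.
exists f => //; rewrite /Pi /chain_forest (traversal_forest tw) //.
have pT : perm_eq [seq f c | c <- C] T.
  apply: perm_trans (perm_map f (perm_right_std M)) _.
  by rewrite (map_matching fM).
apply: (@right_std_eq n) => //.
  by apply: is_matching_perm mT; rewrite perm_sym.
rewrite (sorted_pairwise geq2_trans) pairwise_map.
have := right_std_sorted M; rewrite (sorted_pairwise geq2_trans).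
apply: (@sub_in_pairwise _ (mem M)); last first.
  by apply/allP=> c; rewrite mem_right_std.
move=> c d /arc_atP[i iN ->] /arc_atP[j jN ->]; move=> /= ij.
change ((f (arc_at M j)).2 <= (f (arc_at M i)).2); rewrite !fM //.
by rewrite leqNgt -(arc_at_snd_mono admx) // -leqNgt.
Qed.

Lemma perm_Pi_matching : perm_eq (Pi C) T.
Proof.
have [f fM ->] := Pi_matching.
apply: perm_trans (perm_map f (perm_right_std M)) _.
by rewrite (map_matching fM).
Qed.

Lemma root_code_mono i j : i < j -> b i < b j.
Proof.
elim: j => // j IH; rewrite ltnS leq_eqVlt => /predU1P[->|/IH ij].
  exact: ltn_root_codeS.
exact: ltn_trans ij (ltn_root_codeS x j).
Qed.

(** In [T] the arc number [i] starts at [b i], which increases with [i]; the left-standard order is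
    thus the reverse of the order of insertion. *)
Lemma left_std_Pi : left_std (Pi C) = rev T.
Proof.
apply: (@left_std_eq n).
- by apply: is_matching_perm mT; rewrite perm_sym perm_Pi_matching.
- by apply: perm_trans perm_Pi_matching _; rewrite perm_sym perm_rev.
- apply: sorted_rev_matching => i j /andP[ij jN].
  rewrite !root_arc_fst //; last exact: ltn_trans ij jN.
  exact/ltnW/root_code_mono.
Qed.

(** Label 1 goes to the last inserted arc, number [n - 1], so the process treats the arcs in the
    reverse order of insertion. *)
Lemma secondary_label_arc_at i : i < n ->
  secondary_label C (arc_at M i) = n - i.
Proof.
move=> iN; rewrite /secondary_label left_std_Pi /right_corresponding.
have [f fM ->] := Pi_matching.
have MC : arc_at M i \in C by rewrite mem_right_std mem_arc_at.
rewrite (nth_map (0, 0)) ?index_mem // nth_index // fM //.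
have -> : arc_at T i = nth (0, 0) (rev T) (n - i.+1).
  rewrite nth_rev ?size_matching; last by lia.
  by rewrite /arc_at; congr (nth _ _ _); lia.
rewrite index_uniq ?size_rev ?size_matching ?rev_uniq //; try lia.
exact: is_matching_uniq mT.
Qed.

Lemma secondary_order :
  sort (fun c d => secondary_label C c <= secondary_label C d) C = rev M.
Proof.
apply: sort_eq_in.
- by move=> c d; apply: leq_total.
- by move=> d c e; apply: leq_trans.
- move=> c d; rewrite !mem_right_std => /arc_atP[i iN ->] /arc_atP[j jN ->].
  rewrite -eqn_leq !secondary_label_arc_at // => /eqP e.
  by congr (arc_at _ _); lia.
- by apply: perm_trans (perm_right_std M) _; rewrite perm_sym perm_rev.
- apply: sorted_rev_matching => i j /andP[ij jN].
  by rewrite !secondary_label_arc_at //; lia.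
Qed.

End PiMatching.

(** * The process *)

Lemma find_iota (p : pred nat) N m : m < N -> p m ->
  (forall i, i < m -> ~~ p i) -> find p (iota 0 N) = m.
Proof.
move=> mN pm np; have hp : has p (iota 0 N).
  by apply/hasP; exists m => //; rewrite mem_iota.
have fN : find p (iota 0 N) < N by rewrite -[X in _ < X](size_iota 0) -has_find.
have := nth_find 0 hp; rewrite nth_iota // add0n.
case: (ltngtP (find p (iota 0 N)) m) => // [/np/negP//|mf].
by have := before_find 0 mf; rewrite nth_iota // add0n pm.
Qed.

Lemma rev_matching x b n :
  rev (matching x b n) =
  [seq arc_at (matching x b n) i | i <- rev (iota 0 n)].
Proof. by rewrite map_rev -/(mkseq _ _) -matching_mkseq. Qed.

Lemma shift_vertex_moved a b : a <= b -> shift_vertex a (b - a) a = b.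
Proof. by move=> ab; rewrite /shift_vertex eqxx subnKC. Qed.

Lemma shift_vertex_fixed a b v : a <= b -> b < v ->
  shift_vertex a (b - a) v = v.
Proof. by rewrite /shift_vertex => ab bv; do ?case: ifP; lia. Qed.

Lemma shift_vertex_spread a b v : a <= b ->
  shift_vertex a (b - a) (spread a b v) = spread b b v.
Proof. by rewrite /shift_vertex /spread => ab; do ?case: ifP; lia. Qed.

Lemma shift_vertex_spread_late a b c v : a <= b -> b < c ->
  shift_vertex a (b - a) (spread c c v) =
  spread c c (shift_vertex a (b - a) v).
Proof. by rewrite /shift_vertex /spread => ab bc; do ?case: ifP; lia. Qed.

(* [z] moves the left-hand end of the arc [k], and no later one. *)
Section OneMove.

Context (b z : nat -> nat) (k : nat).

Definition late n := forall j, k < j -> j < n -> z j = b j.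

Lemma lateS n : late n.+1 -> late n.
Proof. by move=> lt j kj jn; apply: lt => //; apply: ltnW. Qed.

Lemma admissible_lt n i j : admissible z b n -> i < j -> j <= n -> b i < b j.
Proof.
move=> adm; elim: j => // j IH; rewrite ltnS leq_eqVlt => /predU1P[->|ij] jn.
  by have [] := adm j jn.
have [_ _] := adm j jn; apply: ltn_trans; apply: IH => //; exact: ltnW.
Qed.

Lemma moved_arc n : admissible z b n -> late n -> k < n ->
  arc_at (matching z b n) k = (z k, (arc_at (matching b b n) k).2).
Proof.
elim: n => // n IH adm lt kn; rewrite !arc_at_rcons //.
have [ek|nk] := eqVneq k n; first by rewrite ek.
have kn' : k < n by lia.
have [zb _ _] := adm k kn; have bk := admissible_lt adm kn' (leqnSn n).
rewrite lt // (IH (admissibleW (leqnSn n) adm) (lateS lt) kn') /spread_arc /=.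
by congr (_, _); rewrite /spread; lia.
Qed.

Lemma later_arc n i : late n -> k < i -> i < n ->
  arc_at (matching z b n) i = arc_at (matching b b n) i.
Proof.
elim: n => // n IH lt ki iN; rewrite !arc_at_rcons //.
have [ei|ni] := eqVneq i n; first by rewrite lt // -ei.
have iN' : i < n by lia.
by rewrite lt ?IH //; [exact: lateS | lia].
Qed.

(** What right-agreement up to [b k + 1] requires of the arcs before [k]: they start outside the
    agreeing part, and their right-hand ends inside it are already those of the target. *)
Lemma earlier_arc n i : admissible z b n -> late n -> i < k -> k < n ->
  let c := arc_at (matching z b n) i in
  let c' := arc_at (matching b b n) i in
  c.1 <= b k /\ ((b k < c.2) || (b k < c'.2) -> c.2 = c'.2).
Proof.
elim: n => // n IH adm lt ik kn c c'.
have adm' := admissibleW (leqnSn n) adm.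
have [zb _ _] := adm k kn.
rewrite /c /c' !arc_at_rcons; [|lia|lia].
have -> : (i == n) = false by lia.
have [ek|nk] := eqVneq k n.
  rewrite -ek in adm' *; rewrite /= /spread.
  have := arc_at_fst_lt adm' ik; have /= := arc_at_snd_open adm' ik.
  by lia.
have kn' : k < n by lia.
have /= [c1 c2] := IH adm' (lateS lt) ik kn'.
have bk := admissible_lt adm kn' (leqnSn n).
by rewrite lt //= /spread; lia.
Qed.

Definition undo (i : nat) : nat := if i == k then b k else z i.

(** At the time of insertion [k] the move turns an insertion at [z k] into one at [b k]. Later
    insertions occur at positions [b j > b k], and the move commutes with them. *)
Lemma shift_matching n i : admissible z b n -> late n -> k < n -> i < n ->
  let s := shift_vertex (z k) (b k - z k) in
  let c := arc_at (matching z b n) i in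
  (s c.1, s c.2) = arc_at (matching undo b n) i.
Proof.
elim: n i => // n IH i adm lt kn iN s c.
have adm' := admissibleW (leqnSn n) adm; have [zb _ _] := adm k kn.
rewrite /c !arc_at_rcons //.
have [ek|nk] := eqVneq k n.
  rewrite -ek /undo eqxx; case: (i == k).
    by rewrite /s /= shift_vertex_moved // shift_vertex_fixed ?ltnSn.
  rewrite (@eq_matching (fun i => if i == k then b k else z i) z); last first.
    by move=> j; case: eqP => // ->; rewrite ltnn.
  by rewrite /spread_arc /s /= !shift_vertex_spread.
have kn' : k < n by lia.
have bk := admissible_lt adm kn' (leqnSn n).
have -> : undo n = b n by rewrite /undo eq_sym (negPf nk) lt.
rewrite lt //; case: eqP => [_|ni].
  by rewrite /s /= !shift_vertex_fixed // ltnW.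
have iN' : i < n by lia.
rewrite -(IH i adm' (lateS lt) kn' iN') /spread_arc /s /=.
by rewrite !shift_vertex_spread_late.
Qed.

End OneMove.


Lemma perm_refl_eq (T : eqType) (s t : seq T) : s = t -> perm_eq s t.
Proof. by move->. Qed.

Lemma eq_filter_map (T : eqType) (S U : Type) (f g : T -> S) (h h' : S -> U)
    (p q : pred S) s :
  {in s, forall i, p (f i) = q (g i)} ->
  {in s, forall i, p (f i) -> h (f i) = h' (g i)} ->
  [seq h c | c <- [seq f i | i <- s] & p c] =
  [seq h' c | c <- [seq g i | i <- s] & q c].
Proof.
move=> pq hh; rewrite !filter_map -!map_comp.
rewrite (@eq_in_filter _ _ (preim g q)); last by move=> i /pq.
apply/eq_in_map => i; rewrite mem_filter => /andP[qi si] /=.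
by apply: hh => //; rewrite pq.
Qed.

Lemma set_nth_rev_mkseq (f g : nat -> nat) n k : k < n ->
  (forall i, i < n -> i != k -> f i = g i) ->
  set_nth 0 (rev (mkseq f n)) (n - k.+1) (g k) = rev (mkseq g n).
Proof.
move=> kn fg; apply: (@eq_from_nth _ 0).
  by rewrite size_set_nth !size_rev !size_mkseq; lia.
move=> i; rewrite size_set_nth size_rev size_mkseq => iN.
have {}iN : i < n by lia.
rewrite nth_set_nth /= !nth_rev ?size_mkseq // !nth_mkseq; try lia.
case: eqP => [->|ne]; first by congr g; lia.
by apply: fg; lia.
Qed.

Lemma process_step_undo n (b z : nat -> nat) k (X : nat -> nat) :
  admissible z b n -> late b z k n -> k < n -> b k <= k.*2 -> z k < b k ->
  process_step n (rev (matching b b n))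
    (rev (matching z b n), rev (mkseq X n)) =
  (rev (matching (undo b z k) b n),
   rev (mkseq (fun i => if i == k then b k - z k else X i) n)).
Proof.
move=> adm lt kn bk zbk.
have admb : admissible b b n by move=> i /adm[].
have mM := matchingP adm; have mT := matchingP admb.
set M := matching z b n in mM *; set T := matching b b n in mT *.
have Mk : arc_at M k = (z k, (arc_at T k).2) by apply: moved_arc.
have Tk1 : (arc_at T k).1 = b k by apply: root_arc_fst.
have late_eq i : k < i -> i < n -> arc_at M i = arc_at T i.
  by move=> ki iN; apply: later_arc ki iN.
have Tlate i : k < i -> i < n -> b k < (arc_at T i).1.
  move=> ki iN; rewrite /T root_arc_fst //.
  by apply: (admissible_lt adm) => //; apply: ltnW.
have early i : i < k -> (arc_at M i).1 <= b k /\
    ((b k < (arc_at M i).2) || (b k < (arc_at T i).2) ->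
     (arc_at M i).2 = (arc_at T i).2).
  by move=> ik; apply: (earlier_arc adm lt ik kn).
have Tearly i : i < k -> (arc_at T i).1 <= b k.
  by move=> ik; have [] := earlier_arc admb (fun _ _ _ => erefl) ik kn.
have MkM : arc_at M k \in M by apply: mem_arc_at.
(* The arcs number [k] of both diagrams share their right-hand end and differ on the left, and only
   one arc of [M] has this right-hand end. *)
have TkM : arc_at T k \notin M.
  apply/negP=> TkM; have := matching_snd_inj mM TkM MkM.
  by rewrite Mk => /(_ erefl) e; move: Tk1; rewrite e /=; lia.
have neq : perm_eq (rev M) (rev T) = false.
  apply/negP=> /perm_mem/(_ (arc_at T k)).
  by rewrite !mem_rev (negPf TkM) mem_arc_at.
have idx i : i \in rev (iota 0 n) -> i < n by rewrite mem_rev mem_iota.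
have leftM i : i < n -> (b k < (arc_at M i).1) = (k < i).
  move=> iN; case: (ltngtP k i) => [ki|ik|<-].
  - by rewrite late_eq // Tlate.
    by have [] := early i ik; lia.
  by rewrite Mk /=; lia.
have leftT i : i < n -> (b k < (arc_at T i).1) = (k < i).
  move=> iN; case: (ltngtP k i) => [ki|/Tearly|<-]; first by rewrite Tlate.
    by lia.
  by rewrite Tk1; lia.
have agree : right_agree (rev M) (rev T) (b k).+1.
  rewrite /right_agree /M /T !rev_matching -/M -/T.
  apply/andP; split; apply: perm_refl_eq.
    rewrite -[LHS]map_id -[RHS]map_id; refine (eq_filter_map _ _).
      by move=> i /idx iN; rewrite leftM // leftT.
    by move=> i /idx iN; rewrite leftM // => ki; rewrite late_eq.
  refine (eq_filter_map _ _).
    move=> i /idx iN /=; rewrite !ltnS ![_.1 <= b k]leqNgt leftM // leftT //.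
    case: (ltngtP k i) => //= [/early[_ h]|<-]; last by rewrite Mk.
    by move: h; lia.
  move=> i /idx iN /andP[]; rewrite ltnS leqNgt leftM //.
  case: (ltngtP k i) => //= [/early[_ h] _ h'|<- _ _]; last by rewrite Mk.
  by apply: h; rewrite h'.
(* The arc [k] of the target starts at [b k]: it lies in the restriction for every threshold up to
   [b k], and it is missing from [M]. So the maximal agreement is up to [b k + 1] exactly. *)
have disagree m : m <= b k -> ~~ right_agree (rev M) (rev T) m.
  move=> mb; apply/negP=> /andP[/perm_mem/(_ (arc_at T k)) + _].
  by rewrite !mem_filter !mem_rev (negPf TkM) andbF mem_arc_at // Tk1 mb.
rewrite /process_step neq.
rewrite (@find_iota _ _ (b k).+1); first 1 last.
- by lia.
- by rewrite /max_right_agree agree disagree.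
- by move=> i ib; rewrite /max_right_agree (negPf (disagree i _)).
(* The arcs entirely in the agreeing part are those inserted after [k], so [r = n - k - 1], which is
   the index of arc [k] in the reversed lists. *)
have -> : count (fun a : darc => b k < a.1) (rev M) = n - k.+1.
  rewrite count_rev /M matching_mkseq -/M count_map.
  rewrite (@eq_in_count _ _ (leq k.+1)); last first.
    by move=> i; rewrite mem_iota /= add0n => iN; rewrite leftM.
  by rewrite count_leq_iota.
rewrite !nth_rev ?size_matching; try lia.
have -> : n - (n - k.+1).+1 = k by lia.
rewrite -/(arc_at M k) -/(arc_at T k) Mk Tk1 /= map_rev.
congr (rev _, _).
  apply: map_matching => i iN; exact: shift_matching.
have := @set_nth_rev_mkseq X (fun i => if i == k then b k - z k else X i) n k.
by rewrite eqxx; apply=> // i _ /negPf->.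
Qed.

Lemma process_matching n x : code n x ->
  overhang_sizes n (right_std (matching x (root_code x) n)) =
  rev (mkseq (fun i => root_code x i - x i) n).
Proof.
move=> cx; rewrite /overhang_sizes /process secondary_order // left_std_Pi //.
set b := root_code x.
(* [S k] is the state in which the arcs from number [k] on have been treated: the process starts at
   [S n] and ends at [S 0]. *)
pose z k i := if i < k then x i else b i.
pose X k i := if i < k then 0 else b i - x i.
pose S k := (rev (matching (z k) b n), rev (mkseq (X k) n)).
(* An arc with [x k = b k] consumes no round, since [S k.+1] and [S k] then coincide. So [k] rounds
   suffice, and the surplus ones fix [S 0]. *)
have step k m : k <= m -> k <= n ->
    iter m (process_step n (rev (matching b b n))) (S k) = S 0.
  elim: k m => [|k IH] m km kn.
    elim: m {km} => //= m ->; rewrite /process_step /S.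
    by rewrite (@eq_matching (z 0) b) // perm_refl.
  have [bk|bk] := eqVneq (x k) (b k).
    have -> : S k.+1 = S k; last by apply: IH; exact: ltnW.
    rewrite /S; congr (rev _, rev _).
      apply: eq_matching => i _; rewrite /z ltnS leq_eqVlt.
      by case: eqP => // ->; rewrite ltnn.
    apply: eq_map => i; rewrite /X ltnS leq_eqVlt.
    by case: eqP => //= ->; rewrite ltnn bk subnn.
  case: m km => // m km; rewrite iterSr -(IH m) //; last exact: ltnW.
  congr iter; rewrite /S (@process_step_undo _ _ _ k) //.
  - congr (rev _, rev _).
      apply: eq_matching => i _; rewrite /undo /z ltnS leq_eqVlt.
      by case: eqP => // ->; rewrite ltnn.
    apply: eq_map => i; rewrite /X /z ltnSn ltnS leq_eqVlt.
    by case: eqP => //= ->; rewrite ltnn.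
  - apply: (root_code_admissible cx) => i _; rewrite /z.
    by case: ifP => // _; apply: root_code_ge.
  - by move=> j kj jn; rewrite /z ltnNge kj.
  - by apply: (root_code_le cx.1); apply: ltnW.
  - by rewrite /z ltnSn ltn_neqAle bk root_code_ge.
have -> : (rev (matching x b n), nseq n 0) = S n.
  rewrite /S; congr (rev _, _).
    by apply: eq_matching => i iN; rewrite /z iN.
  apply: (@eq_from_nth _ 0); rewrite ?size_rev ?size_mkseq ?size_nseq //.
  move=> i iN; rewrite nth_nseq iN nth_rev size_mkseq // nth_mkseq; last by lia.
  by rewrite /X ifT //; lia.
rewrite step //=; congr rev.
Qed.

(** * Codes of paths *)

Definition starts_from (u : point) (p : seq step) : seq point :=
  [seq us.1 | us <- zip (u :: scanl do_step u p) p & us.2 == Up].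

Lemma starts_from_cons u s p :
  starts_from u (s :: p) =
  (if s == Up then [:: u] else [::]) ++ starts_from (do_step u s) p.
Proof. by rewrite /starts_from /=; case: (s == Up). Qed.

Lemma starts_from_cat u p q :
  starts_from u (p ++ q) =
  starts_from u p ++ starts_from (foldl do_step u p) q.
Proof.
elim: p u => //= s p IH u.
by rewrite !starts_from_cons IH catA.
Qed.

Definition pt (j h : nat) : point := (Posz j, Posz h).

(* The starting point of the step of form (1) on the line [x + y = 2k]. *)
Definition start (x : nat -> nat) (k : nat) : point := pt (x k) (k.*2 - x k).

Lemma PhiTL_starts b n T : admissible b b n -> perm_eq T (matching b b n) ->
  up_starts (PhiTL n T) = [seq start b i | i <- iota 0 n].
Proof.
move=> adm pT.
have lt_b i j : i < j -> j < n -> b i < b j.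
  by move=> ij jn; apply: (admissible_lt adm) => //; apply: ltnW.
have memT v : (v \in [seq a.1 | a <- T]) = (v \in [seq b i | i <- iota 0 n]).
  rewrite (perm_mem (perm_map _ pT)) matching_mkseq -map_comp.
  congr (_ \in _); apply/eq_in_map => i; rewrite mem_iota => /andP[_ iN] /=.
  exact: root_arc_fst.
(* The number of steps of form (1) among the first [N] steps, so that the path is then at
   [(N, 2 c N - N)]. *)
pose c N := count (fun i => b i < N) (iota 0 n).
have cb i : i < n -> c (b i) = i.
  move=> iN; rewrite /c (@eq_in_count _ _ (gtn i)).
    by rewrite count_gtn_iota; lia.
  move=> j; rewrite mem_iota /= => jN.
  case: (ltngtP j i) => [ji|ij|->]; last by rewrite ltnn.
    by rewrite lt_b.
  by have := lt_b i j ij jN; lia.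
have cbS i : i < n -> c (b i).+1 = i.+1.
  move=> iN; rewrite /c (@eq_in_count _ _ (gtn i.+1)).
    by rewrite count_gtn_iota; lia.
  move=> j; rewrite mem_iota /= => jN.
  case: (ltngtP j i) => [ji|ij|->]; last by rewrite !ltnSn.
    by have := lt_b j i ji iN; lia.
  by have := lt_b i j ij jN; lia.
pose p N := [seq if v \in [seq a.1 | a <- T] then Up else Down | v <- iota 0 N].
have pS N : p N.+1 = p N ++
    [:: if N \in [seq b i | i <- iota 0 n] then Up else Down].
  by rewrite /p -addn1 iotaD map_cat /= memT.
have key N : foldl do_step origin (p N) = (Posz N, Posz (c N).*2 - Posz N)%R /\
    starts_from origin (p N) = [seq start b i | i <- iota 0 (c N)].
  elim: N => [|N [IHe IHs]].
    by rewrite /c (@eq_count _ _ pred0) ?count_pred0.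
  rewrite pS foldl_cat starts_from_cat IHe IHs.
  case: mapP => [[i]|nN].
    rewrite mem_iota add0n => /= iN eN; subst N; rewrite cbS // cb //.
    have [_ bi _] := adm i iN.
    split; first by rewrite /do_step /step_vec /=; congr (_, _) => /=; lia.
    rewrite starts_from_cons -addn1 iotaD map_cat; congr (_ ++ _).
    by rewrite /= add0n /start /pt; congr [:: (_, _)]; lia.
  have -> : c N.+1 = c N.
    apply: eq_in_count => i; rewrite mem_iota => iN; rewrite ltnS leq_eqVlt.
    by case: eqP => // e; case: nN; exists i; rewrite ?mem_iota.
  rewrite cats0; split=> //.
  rewrite /do_step /step_vec /=; congr (_, _) => /=; lia.
have [_] := key n.*2; rewrite -/(PhiTL n T) (_ : c n.*2 = n) //.
rewrite /c (@eq_in_count _ _ predT) ?count_predT ?size_iota // => i.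
by rewrite mem_iota /= => iN; have [_ bi _] := adm i iN; lia.
Qed.

Definition opath (x : nat -> nat) (n : nat) : seq step :=
  path_through origin [seq start x i | i <- iota 0 n] (start x n).

Lemma start_last n x : code n x -> start x n = (Posz n.*2, 0%R).
Proof. by case=> _ xn; rewrite /start xn subnn. Qed.

Lemma Phi_arcs_matching n x : code n x ->
  Phi_arcs n (right_std (matching x (root_code x) n)) = opath x n.
Proof.
move=> cx; rewrite /Phi_arcs /opath (start_last cx).
rewrite (PhiTL_starts (root_admissible cx)); last exact: perm_Pi_matching.
rewrite process_matching // revK /mkseq zip_map -map_comp.
congr path_through; apply/eq_in_map => i; rewrite mem_iota => /andP[_ iN] /=.
have [xb bi _] := code_admissible cx iN.
by rewrite /start /pt; congr (_, _); lia.
Qed.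

(* The double of the midpoint of the edge over [[j, j + 1]] whose lower end has
   height [m - j].  This edge is of form (1), starting on the line [x + y = m],
   if [m] is even; it lies on the line [x + y = m + 1] if [m] is odd.  In a
   column, [m] increases with the height. *)
Definition mid (j m : nat) : point := (Posz j.*2.+1, Posz (m - j).*2.+1).

Definition edges_from (u : point) (p : seq step) : seq point :=
  pairmap +%R u (scanl do_step u p).

Lemma edges_from_cat u p q :
  edges_from u (p ++ q) = edges_from u p ++ edges_from (foldl do_step u p) q.
Proof. by elim: p u => //= s p IH u; rewrite -IH. Qed.

Lemma do_step_Down j s : j < s ->
  do_step (pt j (s - j)) Down = pt j.+1 (s - j.+1).
Proof. by move=> js; rewrite /do_step /pt; congr (_, _) => /=; lia. Qed.

Lemma do_step_Back j s : j < s ->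
  do_step (pt j.+1 (s - j.+1)) Back = pt j (s - j).
Proof. by move=> js; rewrite /do_step /pt; congr (_, _) => /=; lia. Qed.

Lemma edge_antidiagonal j s : j < s ->
  (pt j (s - j) + pt j.+1 (s - j.+1))%R = mid j s.-1.
Proof. by move=> js; rewrite /pt /mid; congr (_, _) => /=; lia. Qed.

Lemma path_downs s j c : j + c <= s ->
  [/\ foldl do_step (pt j (s - j)) (nseq c Down) = pt (j + c) (s - (j + c)),
      scanl do_step (pt j (s - j)) (nseq c Down) =
        [seq pt i (s - i) | i <- iota j.+1 c] &
      edges_from (pt j (s - j)) (nseq c Down) =
        [seq mid i s.-1 | i <- iota j c]].
Proof.
elim: c j => [|c IH] j jc; first by rewrite addn0.
have js : j < s by lia.
have [|IHe IHs IHm] := IH j.+1; first by lia.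
rewrite /edges_from /= do_step_Down //= edge_antidiagonal //.
by rewrite -/(edges_from _ _) IHe IHm IHs addSnnS.
Qed.

Lemma path_backs s j c : j + c <= s ->
  [/\ foldl do_step (pt (j + c) (s - (j + c))) (nseq c Back) = pt j (s - j),
      scanl do_step (pt (j + c) (s - (j + c))) (nseq c Back) =
        [seq pt i (s - i) | i <- rev (iota j c)] &
      edges_from (pt (j + c) (s - (j + c))) (nseq c Back) =
        [seq mid i s.-1 | i <- rev (iota j c)]].
Proof.
elim: c => [|c IH] jc; first by rewrite addn0.
have js : j + c < s by lia.
have [|IHe IHs IHm] := IH; first by lia.
have -> : rev (iota j c.+1) = j + c :: rev (iota j c).
  by rewrite -addn1 iotaD rev_cat.
rewrite /edges_from addnS /= do_step_Back //= [(pt _ _ + _)%R]addrC.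
by rewrite edge_antidiagonal // -/(edges_from _ _) IHe IHm IHs.
Qed.

(** [L] lists the abscissas of the points visited after the first one, and [L'] those of the
    left-hand ends of the edges. On a line [x + y = s] the abscissa determines the point, so
    repetitions can be excluded on [L] alone. *)
Lemma path_antidiagonal s j j' : j <= s -> j' <= s ->
  exists L L' : seq nat, let u := pt j (s - j) in let v := pt j' (s - j') in
  [/\ foldl do_step u (antidiagonal u v) = v,
      scanl do_step u (antidiagonal u v) = [seq pt i (s - i) | i <- L] &
      edges_from u (antidiagonal u v) = [seq mid i s.-1 | i <- L']] /\
  [/\ uniq (j :: L), {in L, forall i, i <= s}, uniq L' &
    forall i, (i \in L') = (j <= i < j') || (j' <= i < j)].
Proof.
move=> js js'; rewrite /antidiagonal /=.
case: (leqP j j') => jj'.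
  rewrite (_ : (_ <= _)%R = true); last by lia.
  have -> : `|Posz (s - j) - Posz (s - j')|%N = j' - j by lia.
  have [|He Hs Hm] := @path_downs s j (j' - j); first by lia.
  exists (iota j.+1 (j' - j)), (iota j (j' - j)); split; split=> //.
  - by rewrite He subnKC.
  - by rewrite iota_uniq mem_iota ltnn.
  - by move=> i; rewrite mem_iota; lia.
  - exact: iota_uniq.
  - by move=> i; rewrite mem_iota; lia.
rewrite (_ : (_ <= _)%R = false); last by lia.
have -> : `|Posz (s - j') - Posz (s - j)|%N = j - j' by lia.
have [|He Hs Hm] := @path_backs s j' (j - j'); first by lia.
rewrite subnKC in He Hs Hm; last exact: ltnW.
exists (rev (iota j' (j - j'))), (rev (iota j' (j - j'))); split; split=> //.
- by rewrite rev_uniq iota_uniq mem_rev mem_iota; lia.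
- by move=> i; rewrite mem_rev mem_iota; lia.
- by rewrite rev_uniq iota_uniq.
- by move=> i; rewrite mem_rev mem_iota; lia.
Qed.

Lemma path_through_rcons u starts v z :
  path_through u (rcons starts v) z =
  path_through u starts v ++ Up :: antidiagonal (do_step v Up) z.
Proof. by elim: starts u => //= w starts IH u; rewrite IH -catA. Qed.

Lemma opathS x k : opath x k.+1 =
  opath x k ++ Up :: antidiagonal (do_step (start x k) Up) (start x k.+1).
Proof.
by rewrite /opath -[in LHS]addn1 iotaD map_cat cats1 path_through_rcons addn1.
Qed.

Lemma eq_opath x x' n : (forall k, k <= n -> x k = x' k) ->
  opath x n = opath x' n.
Proof.
move=> h; rewrite /opath /start h //; congr path_through.
by apply/eq_in_map => k; rewrite mem_iota => kn; rewrite h //; lia.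
Qed.

Lemma do_step_start x k : x k <= k.*2 ->
  do_step (start x k) Up = pt (x k).+1 (k.*2.+2 - (x k).+1).
Proof. by move=> xk; rewrite /do_step /start /pt; congr (_, _) => /=; lia. Qed.

(* Whether the points of the column [[j, j + 1]] just below the edge [mid j m]
   are in the upper region. *)
Definition above (x : nat -> nat) (j m : nat) : bool := j < x m./2 + odd m.

Definition on_path (x : nat -> nat) (j m : nat) : bool :=
  above x j m != above x j m.+1.

Lemma above_even x j k : above x j k.*2 = (j < x k).
Proof. by rewrite /above doubleK odd_double addn0. Qed.

Lemma above_odd x j k : above x j k.*2.+1 = (j <= x k).
Proof. by rewrite /above /= uphalf_double odd_double addn1. Qed.

Lemma filter_mid j m L : uniq L ->
  [seq e <- [seq mid i m | i <- L] | e.1 == Posz j.*2.+1] =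
  if j \in L then [:: mid j m] else [::].
Proof.
move=> uL; rewrite filter_map.
rewrite (@eq_filter _ _ (pred1 j)); last by move=> i /=; lia.
case: ifP => [jL|/negbT jL]; first by rewrite filter_pred1_uniq.
rewrite (@eq_in_filter _ _ pred0) ?filter_pred0 // => i iL /=.
by apply: contraNF jL => /eqP<-.
Qed.

Lemma foldl_last_scanl (T S : Type) (f : T -> S -> T) (u v : T) s :
  last v (u :: scanl f u s) = foldl f u s.
Proof. by elim: s u => //= a s IH u; rewrite -(IH (f u a)). Qed.

(** The points added by strip [k] lie on the line [x + y = 2k + 2], beyond all earlier ones, so no
    vertex is repeated. The new edges have levels [2k] and [2k + 1], so in each column the path
    meets its edges in increasing order of level. *)
Lemma opath_spec x k : (forall i, i <= k -> x i <= i.*2) ->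
  [/\ foldl do_step origin (opath x k) = start x k,
      uniq (vertices (opath x k)),
      {in vertices (opath x k), forall v : point,
         [&& 0 <= v.1, 0 <= v.2 & v.1 + v.2 <= Posz k.*2]%R} &
      forall j, [seq e <- path_edges (opath x k) | e.1 == Posz j.*2.+1] =
                [seq mid j m | m <- iota 0 k.*2 & on_path x j m]].
Proof.
elim: k => [|k IH] xk.
  have x0 : x 0 = 0 by have := xk 0 (leqnn _); lia.
  rewrite /opath /= /antidiagonal /start x0 /=; split=> // v.
  by rewrite inE => /eqP->.
have [IHe IHu IHr IHm] := IH (fun i ik => xk i (leqW ik)).
have xk0 := xk k (leqnSn k); have xk1 := xk k.+1 (leqnn _).
have [||L [L' [[Le Ls Lm] [uL Ls' uL' memL']]]] :=
  @path_antidiagonal k.*2.+2 (x k).+1 (x k.+1); [lia|lia|].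
rewrite -do_step_start // in Le Ls Lm.
rewrite opathS; split.
- by rewrite foldl_cat IHe.
- rewrite /vertices scanl_cat -cat_cons cat_uniq -/(vertices _) IHu IHe.
  rewrite [scanl _ _ (Up :: _)]/= Ls do_step_start //.
  rewrite -[pt _ _ :: _]/([seq pt i (k.*2.+2 - i) | i <- (x k).+1 :: L]).
  rewrite map_inj_uniq ?uL ?andbT; last by move=> i i' [].
  apply/hasPn => v /mapP[i iL ->]; apply/negP=> /IHr /=.
  have : i <= k.*2.+2 by move: iL; rewrite inE => /predU1P[->|/Ls' //]; lia.
  by lia.
- move=> v; rewrite /vertices scanl_cat -cat_cons mem_cat -/(vertices _) IHe.
  case/orP=> [/IHr|]; first by rewrite doubleS; lia.
  rewrite [scanl _ _ (Up :: _)]/= Ls do_step_start //.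
  rewrite -[pt _ _ :: _]/([seq pt i (k.*2.+2 - i) | i <- (x k).+1 :: L]).
  case/mapP=> i iL ->; rewrite /pt /=.
  have : i <= k.*2.+2 by move: iL; rewrite inE => /predU1P[->|/Ls' //]; lia.
  by lia.
- move=> j; rewrite /path_edges -/(edges_from _ _) edges_from_cat filter_cat.
  rewrite -/(path_edges _) IHm IHe doubleS -addn2 iotaD filter_cat map_cat.
  congr (_ ++ _); rewrite add0n.
  have -> : edges_from (start x k)
      (Up :: antidiagonal (do_step (start x k) Up) (start x k.+1)) =
    [seq mid i k.*2 | i <- [:: x k]] ++ [seq mid i k.*2.+1 | i <- L'].
    rewrite /edges_from /= -/(edges_from _ _) Lm; congr (_ :: _).
    rewrite do_step_start // /start /pt /mid; congr (_, _) => /=; lia.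
  rewrite filter_cat !filter_mid // inE memL' /=.
  rewrite /on_path -doubleS !above_even !above_odd.
  have -> : ((j < x k) != (j <= x k)) = (j == x k) by lia.
  have -> : ((j <= x k) != (j < x k.+1)) =
      (x k < j < x k.+1) || (x k.+1 <= j < (x k).+1) by lia.
  by case: ifP => _; case: ifP.
Qed.

Lemma last_vertices p : last origin (vertices p) = foldl do_step origin p.
Proof. exact: foldl_last_scanl. Qed.

Lemma overhang_opath n x : code n x -> overhang n (opath x n).
Proof.
move=> cx; have [xe xu xr _] := opath_spec cx.1; apply/and3P; split=> //.
  by apply/allP=> v /xr; rewrite /in_rect; lia.
by rewrite last_vertices xe (start_last cx).
Qed.

(** A step of form (2) next to one of form (2') would revisit a vertex; so between two steps of form
    (1) the path is straight. *)
Lemma path_through_starts u p : uniq (u :: scanl do_step u p) ->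
  p = path_through u (starts_from u p) (foldl do_step u p).
Proof.
elim: p u => [|s p IH] u; first by rewrite /= /antidiagonal lexx subrr.
move=> /[dup] /=; set q := scanl do_step (do_step u s) p.
rewrite -[_ && uniq q]/(uniq (do_step u s :: q)) {}/q.
case/andP=> nu up _; have {up} := IH _ up.
have nu' w : w \in do_step u s :: scanl do_step (do_step u s) p -> w != u.
  by move=> wp; apply: contraNneq nu => e; rewrite -{1}e.
rewrite starts_from_cons; case: s nu' {nu} => nu' /=.
- by rewrite {1}/antidiagonal lexx subrr /= => <-.
- set v := starts_from _ _; set z := foldl _ _ _ => ep.
  have key w : (exists q, p = antidiagonal (do_step u Down) w ++ q) ->
      Down :: antidiagonal (do_step u Down) w = antidiagonal u w.
    case=> q; rewrite /antidiagonal /=; case: lerP => [le _|lt eq].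
      rewrite ifT; last by lia.
      by rewrite -[Down :: _]/(nseq _.+1 Down); congr nseq; lia.
    (* If the remaining line went back, its first step would return to [u]. *)
    have := nu' (do_step (do_step u Down) Back); rewrite eq.
    case E : `|_|%N => [|c]; first by lia.
    rewrite /= !inE eqxx orbT => /(_ isT)/eqP[]; case: (u) => a b.
    by rewrite /do_step /=; congr (_, _) => /=; lia.
  case ev : v ep => [|w v'] /= ep.
    by rewrite -key; [rewrite -ep | exists [::]; rewrite cats0].
  rewrite -key /=; first by rewrite -ep.
  by exists (Up :: path_through (do_step w Up) v' z).
- set v := starts_from _ _; set z := foldl _ _ _ => ep.
  have key w : (exists q, p = antidiagonal (do_step u Back) w ++ q) ->
      Back :: antidiagonal (do_step u Back) w = antidiagonal u w.
    case=> q; rewrite /antidiagonal /=; case: lerP => [le eq|lt _].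
      (* [antidiagonal] treats the empty line as a run of [Down], so length zero belongs to this
         branch although the extended line is a single [Back]. *)
      case E : `|_|%N eq => [|c] eq.
        rewrite ifF; last by lia.
        by rewrite -[[:: Back]]/(nseq 1 Back); congr nseq; lia.
      have := nu' (do_step (do_step u Back) Down); rewrite eq.
      rewrite /= !inE eqxx orbT => /(_ isT)/eqP[]; case: (u) => a b.
      by rewrite /do_step /=; congr (_, _) => /=; lia.
    rewrite ifF; last by lia.
    by rewrite -[Back :: _]/(nseq _.+1 Back); congr nseq; lia.
  case ev : v ep => [|w v'] /= ep.
    by rewrite -key; [rewrite -ep | exists [::]; rewrite cats0].
  rewrite -key /=; first by rewrite -ep.
  by exists (Up :: path_through (do_step w Up) v' z).
Qed.

Lemma starts_from_sum (u : point) p k : (u.1 + u.2 = Posz k.*2)%R ->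
  (forall i, i < size (starts_from u p) ->
     let v : point := nth origin (starts_from u p) i in
     (v.1 + v.2 = Posz (k + i).*2)%R) /\
  (let v : point := foldl do_step u p in
   v.1 + v.2 = Posz (k + size (starts_from u p)).*2)%R.
Proof.
elim: p u k => [|s p IH] u k uk; first by split=> //=; rewrite addn0.
rewrite starts_from_cons; case: s => /=.
- have [|IHs IHe] := IH (do_step u Up) k.+1; first by rewrite /do_step /=; lia.
  by split=> [[|i]|] /=; rewrite ?addn0 // ?addnS -?addSn //; apply: IHs.
- by apply: IH; rewrite /do_step /=; lia.
- by apply: IH; rewrite /do_step /=; lia.
Qed.

Lemma starts_from_sub u p :
  {subset starts_from u p <= u :: scanl do_step u p}.
Proof.
elim: p u => [|s p IH] u v //; rewrite starts_from_cons mem_cat => /orP[].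
  by case: (s == Up) => //; rewrite !inE => ->.
by move=> /IH; rewrite [in X in _ -> X]inE => ->; rewrite orbT.
Qed.

Lemma overhang_code n p : overhang n p -> exists2 x, code n x & p = opath x n.
Proof.
case/and3P=> /allP rect up /eqP last_p.
have e0 : (origin.1 + origin.2 = Posz 0.*2)%R by [].
have [sums sum_end] := starts_from_sum p e0.
have szs : size (starts_from origin p) = n.
  by move: sum_end; rewrite -last_vertices last_p /=; lia.
set s := starts_from origin p in sums szs.
pose x i := if i < n then `|(nth origin s i).1|%N else n.*2.
have xP i : i < n -> nth origin s i = start x i /\ x i <= i.*2.
  move=> iN; have iS : i < size s by rewrite szs.
  have := sums i iS.
  have : nth origin s i \in s by rewrite mem_nth.
  move=> /starts_from_sub/rect; rewrite /in_rect /start /pt /x iN.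
  by case: (nth _ _ _) => a c /=; split; [congr (_, _)|]; lia.
have cx : code n x.
  split; last by rewrite /x ltnn.
  move=> i iN; case: (ltnP i n) => [/xP[] //|ni].
  by rewrite /x ltnNge ni /= leq_double.
exists x => //; rewrite /opath (start_last cx) -last_p last_vertices.
rewrite [LHS](path_through_starts up) -/s; congr path_through.
apply: (@eq_from_nth _ origin); rewrite szs ?size_map ?size_iota // => i iN.
by rewrite (nth_map 0) ?size_iota // nth_iota // add0n; have [] := xP i iN.
Qed.

(** * Columns and lower region of the path of a code *)

Section PathOfCode.

Context (n : nat) (x : nat -> nat).
Hypothesis cx : code n x.

Lemma x_le k : k <= n -> x k <= k.*2.
Proof. exact: cx.1. Qed.

Lemma above_le j m : m <= n.*2 -> above x j m -> j < m.
Proof.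
rewrite /above => mn; have := @x_le m./2.
by have := odd_double_half m; lia.
Qed.

Lemma above_last j : above x j n.*2 = (j < n.*2).
Proof. by rewrite above_even cx.2. Qed.

Lemma mid_inj j m j' m' : j <= m -> j' <= m' -> mid j m = mid j' m' ->
  j = j' /\ m = m'.
Proof. by move=> jm jm' [] e1 e2; lia. Qed.

Lemma on_path_le j m : m < n.*2 -> on_path x j m -> j <= m.
Proof.
move=> mn; have := @above_le j m (ltnW mn); have := @above_le j m.+1 mn.
by rewrite /on_path; lia.
Qed.

Lemma mem_path_edges j m : j <= m ->
  (mid j m \in path_edges (opath x n)) = (m < n.*2) && on_path x j m.
Proof.
move=> jm; have [_ _ _ hm] := opath_spec cx.1.
have -> : (mid j m \in path_edges (opath x n)) =
    (mid j m \in [seq e <- path_edges (opath x n) | e.1 == Posz j.*2.+1]).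
  by rewrite mem_filter eqxx.
rewrite hm; apply/mapP/idP => [[m']|/andP[mn on]].
  rewrite mem_filter mem_iota => /and3P[on _ mn] e.
  by have [_ ->] := mid_inj jm (on_path_le mn on) e; rewrite mn on.
by exists m => //; rewrite mem_filter on mem_iota.
Qed.

Lemma columnE j : column (opath x n) j =
  [seq mid j m | m <- rev [seq m <- iota 0 n.*2 | on_path x j m]].
Proof.
have [_ _ _ hm] := opath_spec cx.1; rewrite /column hm.
apply: sort_eq_in.
- by move=> e f; apply: le_total.
- by move=> f e g fe gf; apply: le_trans gf fe.
- move=> _ _ /mapP[m _ ->] /mapP[m' _ ->] /= h; congr (_, _).
  by apply: le_anti; rewrite andbC.
- by rewrite map_rev perm_sym perm_rev.
- rewrite map_rev rev_sorted sorted_map.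
  apply: (@sub_sorted _ leq) => [m m' mm' /=|]; first by lia.
  exact/(sorted_filter leq_trans)/iota_sorted.
Qed.

(** The tiles on the right of the path in their strip contain the half-diamonds and are closed under
    crossing an edge off the path. Conversely such a tile is reached from the half-diamond of its
    strip by moving left inside the strip, where the only path edge is the one over [x k]; the
    induction is on its height [d]. *)
Lemma lowerP c : lower n (opath x n) c <->
  exists k a, [/\ k < n, x k < a <= k.*2.+1 & c = pt a (k.*2.+1 - a)].
Proof.
split.
  elim=> [k kn|{}c d _ [k [a [kn ka ->]]] dc d2 ne].
    by exists k, k.*2.+1; rewrite subnn ltnS x_le ?leqnn // ltnW.
  have xk := x_le (ltnW kn).
  move: dc; rewrite !inE => /or4P[] /eqP ed; subst d; move: ne d2.
  - have -> : (pt a (k.*2.+1 - a) + (pt a (k.*2.+1 - a) + (1, 1)) =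
        mid a k.*2.+1)%R by rewrite /pt /mid; congr (_, _) => /=; lia.
    rewrite mem_path_edges; last by lia.
    rewrite /on_path above_odd -doubleS above_even => ne _.
    exists k.+1, a.+1; split.
    (* In the last strip [x n = 2n] puts all these edges on the path, so the line [x + y = 2n] is
       not crossed. *)
    + by move: ne; have := cx.2; case: (ltngtP k.+1 n) => [||->]; lia.
    + by move: ne; lia.
    + by rewrite /pt; congr (_, _) => /=; lia.
  - have -> : (pt a (k.*2.+1 - a) + (pt a (k.*2.+1 - a) + (-1, 1)) =
        mid a.-1 k.*2)%R by rewrite /pt /mid; congr (_, _) => /=; lia.
    rewrite mem_path_edges; last by lia.
    rewrite /on_path above_odd above_even => ne _.
    exists k, a.-1; split=> //; first by move: ne; lia.
    by rewrite /pt; congr (_, _) => /=; lia.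
  - move=> _ /= d2; exists k, a.+1; split=> //; first by lia.
    by rewrite /pt; congr (_, _) => /=; lia.
  - move=> ne /= d2; move: ne; case: k kn ka xk d2 => [|k] kn ka xk d2.
      by lia.
    have -> : (pt a (k.+1.*2.+1 - a) + (pt a (k.+1.*2.+1 - a) + (-1, -1)) =
        mid a.-1 k.*2.+1)%R by rewrite /pt /mid; congr (_, _) => /=; lia.
    rewrite mem_path_edges; last by lia.
    rewrite /on_path above_odd -doubleS above_even => ne.
    exists k, a.-1; split; first by lia.
      by move: ne; lia.
    by rewrite /pt; congr (_, _) => /=; lia.
case=> k [a [kn /andP[xa ak] ->]]; have xk := x_le (ltnW kn).
have [d ed] : exists d, a = k.*2.+1 - d by exists (k.*2.+1 - a); lia.
elim: d a xa ak ed => [|d IH] a xa ak ed.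
  by rewrite ed subn0 subnn; apply: lower_base.
have [e|nz] := eqVneq a k.*2.+1; first by rewrite e subnn; apply: lower_base.
apply: (@lower_cross _ _ (pt a.+1 (k.*2.+1 - a.+1))).
- by apply: IH; lia.
- rewrite !inE; apply/orP; right; apply/orP; left; apply/eqP.
  by rewrite /pt; congr (_, _) => /=; lia.
- by rewrite /=; lia.
- have -> : (pt a.+1 (k.*2.+1 - a.+1) + pt a (k.*2.+1 - a) = mid a k.*2)%R.
    by rewrite /pt /mid; congr (_, _) => /=; lia.
  rewrite mem_path_edges; last by lia.
  by rewrite /on_path above_odd above_even; lia.
Qed.

End PathOfCode.

(** * The root *)

Section Root.

Context (n : nat).

Lemma code_root x : code n x -> code n (root_code x).
Proof.
move=> cx; split; first exact: root_code_le cx.1.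
apply/eqP; rewrite eqn_leq (root_code_le cx.1) //=.
by rewrite -{1}cx.2 root_code_ge.
Qed.

Lemma Back_antidiagonal (u v : point) :
  (Back \in antidiagonal u v) = (u.2 < v.2)%R.
Proof.
rewrite /antidiagonal; case: lerP => uv; rewrite mem_nseq //= ?andbF //.
by rewrite andbT; lia.
Qed.

Lemma Back_opath x k : (forall i, i <= k -> x i <= i.*2) ->
  reflect (forall i, i < k -> x i < x i.+1) (Back \notin opath x k).
Proof.
move=> xk; apply: (iffP idP).
  elim: k xk => // k IH xk.
  rewrite opathS mem_cat inE negb_or /= => /andP[/IH h].
  rewrite do_step_start ?xk // Back_antidiagonal -leNgt /= => hk i.
  have xk1 := xk k.+1 (leqnn _); have xk0 := xk k (leqnSn k).
  rewrite ltnS leq_eqVlt => /predU1P[->|ik]; first by lia.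
  by apply: h => // j jk; apply: xk; apply: leqW.
elim: k xk => [xk _|k IH xk h].
  rewrite -[opath _ _]/(antidiagonal origin (start x 0)) Back_antidiagonal.
  by have := xk 0 (leqnn _); rewrite /start /=; lia.
rewrite opathS mem_cat inE negb_or /= IH; first 1 last.
- by move=> j jk; apply: xk; apply: leqW.
- by move=> i ik; apply: h; apply: leqW.
rewrite do_step_start ?xk // Back_antidiagonal -leNgt /=.
have xk1 := xk k.+1 (leqnn _); have := h k (ltnSn k).
by lia.
Qed.

Lemma dyck_opath x : code n x -> (forall k, k < n -> x k < x k.+1) ->
  dyck n (opath x n).
Proof.
by move=> cx h; rewrite /dyck overhang_opath //; apply/(Back_opath cx.1).
Qed.

Lemma dyck_code t : dyck n t -> exists c, [/\ code n c,
  forall k, k < n -> c k < c k.+1 & t = opath c n].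
Proof.
case/andP=> /overhang_code[c cc ->] h; exists c; split=> //.
exact/(Back_opath cc.1).
Qed.

(** The leftmost lower tile of a strip, of abscissa [x k + 1], already tests the inequality for this
    strip. *)
Lemma path_leP x y : code n x -> code n y ->
  Defs.path_le n (opath x n) (opath y n) <-> forall k, k < n -> y k <= x k.
Proof.
move=> cx cy; split=> [le k kn|le c].
  have xk := cx.1 _ (ltnW kn).
  have : lower n (opath x n) (pt (x k).+1 (k.*2.+1 - (x k).+1)).
    by apply/(lowerP cx); exists k, (x k).+1; split=> //; lia.
  move=> /le/(lowerP cy)[k' [a [_ h [e1 e2]]]].
  have ek : k' = k by lia.
  by rewrite ek in h; lia.
move=> /(lowerP cx)[k [a [kn ka ->]]].
apply/(lowerP cy); exists k, a; split=> //.
by have := le k kn; lia.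
Qed.

(** Lower regions shrink as codes grow, and a path is a Dyck path when its code increases strictly.
    So the root corresponds to the least strictly increasing code above [x], which the recursive
    maximum produces. *)
Lemma root_code_min x c : (forall k, k < n -> c k < c k.+1) ->
  (forall k, k < n -> x k <= c k) -> forall k, k < n -> root_code x k <= c k.
Proof.
move=> incr xc; elim=> [|k IH] kn /=; first exact: xc.
have := IH (ltnW kn); have := incr k (ltnW kn); have := xc _ kn.
by lia.
Qed.

Lemma is_rootP x t : code n x ->
  is_root n (opath x n) t <-> t = opath (root_code x) n.
Proof.
move=> cx; have cb := code_root cx.
have db : dyck n (opath (root_code x) n).
  by apply: dyck_opath => // k _; apply: ltn_root_codeS.
have leb : Defs.path_le n (opath (root_code x) n) (opath x n).
  by apply/path_leP => // k _; apply: root_code_ge.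
have maxb s : dyck n s -> Defs.path_le n s (opath x n) ->
    Defs.path_le n s (opath (root_code x) n).
  move=> /dyck_code[c [cc incr ->]] /path_leP-/(_ cc cx) xc.
  by apply/path_leP => //; apply: root_code_min.
split=> [[dt tx tmax]|->].
  by apply/esym/tmax => //; apply: maxb.
split=> // s /[dup] ds /dyck_code[c [cc incr es]] sx bs.
have := maxb s ds sx; move: bs; rewrite es.
move=> /path_leP-/(_ cb cc) h1 /path_leP-/(_ cc cb) h2.
apply: eq_opath => k; rewrite leq_eqVlt => /predU1P[->|kn].
  by rewrite cc.2 cb.2.
by apply/eqP; rewrite eqn_leq h1 ?h2.
Qed.

Lemma lower_rootP x c : code n x ->
  lower_root n (opath x n) c <-> lower n (opath (root_code x) n) c.
Proof.
move=> cx; split=> [[t /(is_rootP _ cx)->] //|lc].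
by exists (opath (root_code x) n) => //; apply/is_rootP.
Qed.

End Root.

(* The level of the edge of the path reached when one goes down in column [j]
   from the edge [mid j m] through the upper region. *)
Fixpoint descend (x : nat -> nat) (j m : nat) : nat :=
  if m is m'.+1 then if above x j m then descend x j m' else m else 0.

Lemma descend_above x j m : above x j m.+1 ->
  descend x j m.+1 = descend x j m.
Proof. by move=> /= ->. Qed.

Lemma descend_id x j m : ~~ above x j m -> descend x j m = m.
Proof. by case: m => //= m /negPf->. Qed.

Lemma descend_le x j m : descend x j m <= m.
Proof. by elim: m => //= m IH; case: ifP => // _; apply: leqW. Qed.

Lemma descend_not_above x j m : x 0 = 0 -> ~~ above x j (descend x j m).
Proof.
move=> x0; elim: m => [|m IH]; first by rewrite /above /= x0.
by rewrite /=; case: ifP => // ->.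
Qed.

Lemma descend_max x j r m : r <= m -> ~~ above x j r -> r <= descend x j m.
Proof.
elim: m => //= m IH; rewrite leq_eqVlt => /predU1P[->|rm] nr.
  by rewrite (negPf nr).
by case: ifP => _; [apply: IH | apply: ltnW].
Qed.

(** * Pairing of the path edges of a column through the upper region *)

Section Column.

Context (x : nat -> nat) (j : nat).
Hypothesis x0 : x 0 = 0.

Let rl N := rev [seq m <- iota 0 N | on_path x j m].

Let rlS N : rl N.+1 = if on_path x j N then N :: rl N else rl N.
Proof.
rewrite /rl -addn1 iotaD filter_cat rev_cat /=.
by case: ifP.
Qed.

Lemma path_levels_above N : above x j N ->
  rl N = descend x j N :: rl (descend x j N).
Proof.
elim: N => [|N IH] aN; first by rewrite /above /= x0 in aN.
rewrite rlS /on_path aN descend_above //.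
have [aN'|nN] := boolP (above x j N); first by rewrite IH.
by rewrite descend_id.
Qed.

(** Below a place outside the upper region, the path edges alternately enter and leave the upper
    region on the way down; so the edges of index [2i] and [2i + 1] bound one vertical segment. The
    induction is strong because it jumps over such a segment at once. *)
Lemma path_levels_pair N : ~~ above x j N ->
  forall i, i.*2.+1 < size (rl N) ->
  exists m, [/\ m < N, above x j m, ~~ above x j m.+1,
    nth 0 (rl N) i.*2 = m & nth 0 (rl N) i.*2.+1 = descend x j m].
Proof.
have [M] := ubnP N; elim: M N => // M IH [|N] NM nN i //.
rewrite rlS /on_path (negPf nN); have [aN|nN'] := boolP (above x j N) => /=.
  rewrite path_levels_above //; case: i => [|i] /= h; first by exists N.
  have dN := descend_le x j N.
  have ltM : descend x j N < M by apply: leq_ltn_trans dN _.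
  have [|m [mN am nm e1 e2]] := IH _ ltM (descend_not_above j N x0) i.
    by move: h; rewrite doubleS.
  by exists m; split=> //; apply: leq_trans mN (leqW dN).
by move=> /(IH N NM nN')[m [mN am nm e1 e2]]; exists m; split=> //; apply: leqW.
Qed.

Lemma path_levels_index N m : ~~ above x j N -> m < N -> above x j m ->
  ~~ above x j m.+1 ->
  exists i, [/\ i.*2.+1 < size (rl N), nth 0 (rl N) i.*2 = m &
    nth 0 (rl N) i.*2.+1 = descend x j m].
Proof.
have [M] := ubnP N; elim: M N => // M IH [|N] NM nN mN am nm //.
rewrite rlS /on_path (negPf nN); have [aN|nN'] := boolP (above x j N) => /=.
  rewrite path_levels_above //; move: mN.
  rewrite ltnS leq_eqVlt => /predU1P[->|mN]; first by exists 0.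
  have dN := descend_le x j N.
  have ltM : descend x j N < M by apply: leq_ltn_trans dN _.
  have [|i [szi e1 e2]] := IH _ ltM (descend_not_above j N x0) _ am nm.
    exact: descend_max.
  by exists i.+1; rewrite doubleS.
apply: IH => //; move: mN; rewrite ltnS leq_eqVlt => /predU1P[e|//].
by rewrite -e am in nN'.
Qed.

End Column.

(** * Strands *)

(* The number of the arc of [matching x b k] at the vertex [j]. *)
Fixpoint label (x b : nat -> nat) (k j : nat) : nat :=
  if k is k'.+1 then
    if (j == x k') || (j == (b k').+1) then k'
    else label x b k' (gather (x k') (b k') j)
  else 0.

Lemma label_lt x b k j : 0 < k -> label x b k j < k.
Proof.
elim: k j => // k IH j _ /=; case: ifP => // h.
case: k IH h => [|k] IH h; first by rewrite /= ltnS.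
by apply: leqW; apply: IH.
Qed.

Lemma label_old x b k j : j != x k -> j != (b k).+1 ->
  label x b k.+1 j = label x b k (gather (x k) (b k) j).
Proof. by move=> /= /negPf-> /negPf->. Qed.

Lemma label_left x b k j : x k <= b k -> j < x k ->
  label x b k.+1 j = label x b k j.
Proof.
move=> xb jx; rewrite label_old; [|lia|lia].
by congr label; rewrite /gather; lia.
Qed.

Lemma label_middle x b k j : x k < j <= b k ->
  label x b k.+1 j = label x b k j.-1.
Proof.
move=> xjb; rewrite label_old; [|lia|lia].
by congr label; rewrite /gather; lia.
Qed.

Lemma label_right x b k j : x k <= b k -> (b k).+1 < j ->
  label x b k.+1 j = label x b k j.-2.
Proof.
move=> xb bj; rewrite label_old; [|lia|lia].
by congr label; rewrite /gather; lia.
Qed.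

Lemma label_new x b k j : (j == x k) || (j == (b k).+1) ->
  label x b k.+1 j = k.
Proof. by move=> /= ->. Qed.

Section Strands.

Context (n : nat) (x : nat -> nat).
Hypothesis cx : code n x.

Let b := root_code x.
Let p := opath x n.
Let cb : code n b. Proof. exact: code_root. Qed.
Let xb k : x k <= b k. Proof. exact: root_code_ge. Qed.
Let x0 : x 0 = 0. Proof. by have := cx.1 0 (leq0n _); lia. Qed.
Let bk k : k <= n -> b k <= k.*2. Proof. exact: cb.1. Qed.

(* A labelling which is constant on strands.  On the line [x + y = 2k + 2] it is
   read off the diagram of the path truncated at this line; the new strand of
   the strip [k] goes from the step of form (1) of the path through the edges of
   form (1) over [x k, ..., b k]. *)
Definition mid_label (j m : nat) : nat :=
  if odd m then label x b m./2.+1 j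
  else if j <= x m./2 then label x b m./2.+1 j
  else if j <= b m./2 then m./2 else label x b m./2.+1 j.+1.

Lemma mid_label_even j k : mid_label j k.*2 =
  if j <= x k then label x b k.+1 j
  else if j <= b k then k else label x b k.+1 j.+1.
Proof. by rewrite /mid_label odd_double doubleK. Qed.

Lemma mid_label_odd j k : mid_label j k.*2.+1 = label x b k.+1 j.
Proof. by rewrite /mid_label /= odd_double uphalf_double. Qed.

Definition node_label (u : node) : nat :=
  match u with
  | Boundary j => label x b n j
  | Mid e => mid_label (`|e.1|%N./2) (`|e.1|%N./2 + `|e.2|%N./2)
  end.

Lemma node_label_mid j m : j <= m -> node_label (Mid (mid j m)) = mid_label j m.
Proof.
by move=> jm; rewrite /= !uphalf_double subnKC.
Qed.

Lemma mid_label_above j m : above x j m.+1 -> mid_label j m.+1 = mid_label j m.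
Proof.
rewrite -(odd_double_half m); set k := m./2; case: (odd m) => /=.
  rewrite add1n -doubleS above_even => jx.
  rewrite mid_label_even mid_label_odd (ltnW jx) label_left //.
by rewrite add0n above_odd mid_label_odd mid_label_even => ->.
Qed.

Lemma mid_label_descend j m : mid_label j (descend x j m) = mid_label j m.
Proof.
elim: m => //= m IH; case: ifP => // am.
by rewrite IH mid_label_above.
Qed.

Lemma descend_ge j m : j <= m -> m <= n.*2 -> j <= descend x j m.
Proof.
move=> jm mn; apply: descend_max => //.
by apply/negP=> /(above_le cx)-/(_ (leq_trans jm mn)); rewrite ltnn.
Qed.

Lemma tile_upper_edges a k : 0 < a <= k.*2.+1 ->
  NW (pt a (k.*2.+1 - a)) = mid a.-1 k.*2 /\
  NE (pt a (k.*2.+1 - a)) = mid a k.*2.+1.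
Proof.
by move=> ak; split; rewrite /NW /NE /pt /mid; congr (_, _) => /=; lia.
Qed.

Lemma tile_lower_edges a k : 0 < a <= k.*2 ->
  SE (pt a (k.*2.+1 - a)) = mid a k.*2 /\
  SW (pt a (k.*2.+1 - a)) = mid a.-1 k.*2.-1.
Proof.
by move=> ak; split; rewrite /SE /SW /pt /mid; congr (_, _) => /=; lia.
Qed.

Lemma column_pos j : j < n.*2 -> 0 < size (column p j) /\
  nth origin (column p j) 0 = mid j (descend x j n.*2).
Proof.
move=> jn; rewrite /p (columnE cx) size_map path_levels_above ?above_last //.
Qed.

Lemma column_pair j i : j < n.*2 -> i.*2.+2 < size (column p j) ->
  exists m, [/\ m < n.*2, above x j m, ~~ above x j m.+1,
    nth origin (column p j) i.*2.+1 = mid j m &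
    nth origin (column p j) i.*2.+2 = mid j (descend x j m)].
Proof.
move=> jn; rewrite /p (columnE cx) size_map => iS.
rewrite !(nth_map 0) //; last exact: ltnW.
move: iS; rewrite path_levels_above ?above_last // /= ltnS => iS.
have [m [mN am nm -> ->]] :=
  path_levels_pair x0 (descend_not_above j n.*2 x0) iS.
by exists m; split=> //; apply: leq_trans mN (descend_le _ _ _).
Qed.

Lemma column_index j m : j < n.*2 -> m < n.*2 -> above x j m ->
  ~~ above x j m.+1 ->
  exists i, [/\ i.*2.+2 < size (column p j),
    nth origin (column p j) i.*2.+1 = mid j m &
    nth origin (column p j) i.*2.+2 = mid j (descend x j m)].
Proof.
move=> jn mn am nm.
have [|i [iS e1 e2]] :=
  path_levels_index x0 (descend_not_above j n.*2 x0) _ am nm.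
- exact: descend_max.
rewrite /p (columnE cx) size_map; exists i.
have eL := path_levels_above x0 (etrans (above_last cx j) jn).
rewrite !(nth_map 0) eL //=; last exact: ltnW.
by rewrite e1 e2.
Qed.

Lemma mid_label_pred j k : 0 < k -> mid_label j k.*2.-1 = label x b k j.
Proof. by case: k => // k _; rewrite doubleS mid_label_odd. Qed.

(** At [a = b k + 1], the first root tile of the strip, the new strand is turned up to its
    right-hand end; further on the tile carries an older strand. *)
Lemma root_tile_upper a k : b k < a ->
  mid_label a.-1 k.*2 = mid_label a k.*2.+1.
Proof.
move=> ba; rewrite mid_label_even mid_label_odd; have := xb k.
have -> : a.-1.+1 = a by lia.
case: ifP => [ax xk|_ _]; last case: ifP => // ab.
  have [-> ->] : a.-1 = x k /\ a = (b k).+1 by lia.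
  by rewrite !label_new ?eqxx ?orbT.
have -> : a = (b k).+1 by lia.
by rewrite label_new ?eqxx ?orbT.
Qed.

(** Beyond the new right-hand end an older strand crosses the strip through the lower half of one
    root tile and the upper half of the next, moving two places to the right, as in [spread]. *)
Lemma root_tile_lower a k : 0 < k -> b k < a ->
  mid_label a.-1 k.*2.-1 = mid_label a k.*2.
Proof.
move=> k0 ba; have xk := xb k; rewrite mid_label_pred // mid_label_even.
by rewrite ifF ?ifF ?label_right //; lia.
Qed.

Lemma cross_tile_new a k : x k < a <= b k ->
  mid_label a.-1 k.*2 = mid_label a k.*2.
Proof.
move=> xab; rewrite !mid_label_even [a <= x k]leqNgt.
have -> : x k < a by lia.
have -> : a <= b k by lia.
have -> : a.-1 <= b k by lia.
case: ifP => // ax; have -> : a.-1 = x k by lia.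
by rewrite label_new ?eqxx.
Qed.

(** A crossing tile takes an older strand across the new one and moves it a single place: only the
    new left-hand end lies to its left. *)
Lemma cross_tile_old a k : 0 < k -> x k < a <= b k ->
  mid_label a k.*2.+1 = mid_label a.-1 k.*2.-1.
Proof.
by move=> k0 xab; rewrite mid_label_pred // mid_label_odd label_middle.
Qed.

Lemma lower_cross_tile c : lower n p c -> ~ lower_root n p c ->
  exists k a, [/\ k < n, x k < a <= b k & c = pt a (k.*2.+1 - a)].
Proof.
move=> /(lowerP cx)[k [a [kn ka ->]]] nl; exists k, a; split=> //.
case/andP: ka => -> ak; rewrite leqNgt; apply/negP=> ba; apply: nl.
by apply/(lower_rootP _ cx)/(lowerP cb); exists k, a; rewrite ba ak.
Qed.

(** Makes [node_label] an invariant of strands, the only way to show that boundary vertices are not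
    joined. *)
Lemma piece_label u v : strand_piece n p u v -> node_label u = node_label v.
Proof.
case.
- move=> c /(lowerP cx)[k [a [kn ka ->]]] [ak].
  have bkn := bk (ltnW kn).
  have [|-> ->] := @tile_upper_edges a k; first by lia.
  rewrite !node_label_mid ?root_tile_upper //; lia.
- move=> c /(lower_rootP _ cx)/(lowerP cb)[k [a [kn ka ->]]] c2.
  rewrite /= in c2.
  have [|-> ->] := @tile_upper_edges a k; first by lia.
  rewrite !node_label_mid ?root_tile_upper //; lia.
- move=> c /(lower_rootP _ cx)/(lowerP cb)[k [a [kn ka ->]]] c2.
  rewrite /= in c2.
  have bkn := bk (ltnW kn).
  have [|-> ->] := @tile_lower_edges a k; first by lia.
  rewrite !node_label_mid ?root_tile_lower //; lia.
- move=> c lc /(lower_cross_tile lc)[k [a [kn ka ->]]] c2.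
  rewrite /= in c2.
  have bkn := bk (ltnW kn).
  have [|-> _] := @tile_upper_edges a k; first by lia.
have [|-> _] := @tile_lower_edges a k; first by lia.
  rewrite !node_label_mid ?cross_tile_new //; lia.
- move=> c lc /(lower_cross_tile lc)[k [a [kn ka ->]]] c2.
  rewrite /= in c2.
  have bkn := bk (ltnW kn).
  have [|_ ->] := @tile_upper_edges a k; first by lia.
have [|_ ->] := @tile_lower_edges a k; first by lia.
  rewrite !node_label_mid ?cross_tile_old //; lia.
- move=> j jn _; have [_ ->] := column_pos jn.
  rewrite node_label_mid ?descend_ge // ?mid_label_descend; last exact: ltnW.
  (* At the even level [2n] the labelling refers to a strip [n] that does not exist. As the whole
     column is still in the upper region there, the level can be lowered to [2n - 1], where
     [label x b n] is read. *)
  have -> : n.*2 = n.*2.-1.+1 by lia.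
  have n0 : 0 < n by lia.
  rewrite mid_label_above ?mid_label_pred //.
  by rewrite prednK ?above_last //; lia.
- move=> j i jn /(column_pair jn)[m [mn am nm -> ->]].
  have jm := above_le cx (ltnW mn) am.
  rewrite !node_label_mid ?mid_label_descend //; last exact: ltnW.
  by apply: descend_ge; apply: ltnW.
Qed.

Notation "u ~~> v" := (strand n p u v) (at level 70).

Lemma strand_refl u : u ~~> u.
Proof. exact: rst_refl. Qed.

Lemma strand_sym u v : u ~~> v -> v ~~> u.
Proof. exact: rst_sym. Qed.

Lemma strand_trans v u w : u ~~> v -> v ~~> w -> u ~~> w.
Proof. exact: rst_trans. Qed.

Lemma strand_label u v : u ~~> v -> node_label u = node_label v.
Proof.
by elim=> // {}u {}v; [exact: piece_label | move=> w _ -> _ ->].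
Qed.

Lemma strand_root_upper a k : k < n -> b k < a <= k.*2.+1 ->
  Mid (mid a.-1 k.*2) ~~> Mid (mid a k.*2.+1).
Proof.
move=> kn ka; apply: rst_step.
have lr : lower_root n p (pt a (k.*2.+1 - a)).
  by apply/(lower_rootP _ cx)/(lowerP cb); exists k, a.
have [|<- <-] := @tile_upper_edges a k; first by lia.
have [e|ne] := eqVneq a k.*2.+1.
  apply: piece_half; last by rewrite e subnn.
  by apply/(lowerP cx); exists k, a; split=> //; have := xb k; lia.
by apply: piece_root_upper => //=; lia.
Qed.

Lemma strand_root_lower a k : k < n -> b k < a <= k.*2 ->
  Mid (mid a.-1 k.*2.-1) ~~> Mid (mid a k.*2).
Proof.
move=> kn ka; apply: rst_step.
have lr : lower_root n p (pt a (k.*2.+1 - a)).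
  by apply/(lower_rootP _ cx)/(lowerP cb); exists k, a; split=> //; lia.
have [|<- <-] := @tile_lower_edges a k; first by lia.
by apply: piece_root_lower => //=; lia.
Qed.

Lemma cross_tile_lower a k : k < n -> x k < a <= b k ->
  lower n p (pt a (k.*2.+1 - a)) /\ ~ lower_root n p (pt a (k.*2.+1 - a)).
Proof.
move=> kn ka; have bkn := bk (ltnW kn); split.
  by apply/(lowerP cx); exists k, a; split=> //; lia.
move=> /(lower_rootP _ cx)/(lowerP cb)[k' [a' [_ h [e1 e2]]]].
have ek : k' = k by lia.
by rewrite ek -/b in h; lia.
Qed.

Lemma strand_cross_new a k : k < n -> x k < a <= b k ->
  Mid (mid a.-1 k.*2) ~~> Mid (mid a k.*2).
Proof.
move=> kn ka; have bkn := bk (ltnW kn); apply: rst_step.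
have [l nl] := cross_tile_lower kn ka.
have [|<- _] := @tile_upper_edges a k; first by lia.
have [|<- _] := @tile_lower_edges a k; first by lia.
by apply: piece_cross_NW => //=; lia.
Qed.

Lemma strand_cross_old a k : k < n -> x k < a <= b k ->
  Mid (mid a k.*2.+1) ~~> Mid (mid a.-1 k.*2.-1).
Proof.
move=> kn ka; have bkn := bk (ltnW kn); apply: rst_step.
have [l nl] := cross_tile_lower kn ka.
have [|_ <-] := @tile_upper_edges a k; first by lia.
have [|_ <-] := @tile_lower_edges a k; first by lia.
by apply: piece_cross_NE => //=; lia.
Qed.

(** If the points just below the edge are in the upper region, those just above are not, so the edge
    is on the path and a vertical piece starts there; otherwise the descent is empty. *)
Lemma strand_descend j m : j <= m -> m < n.*2 -> ~~ above x j m.+1 ->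
  Mid (mid j m) ~~> Mid (mid j (descend x j m)).
Proof.
move=> jm mn nm; have [am|/descend_id->] := boolP (above x j m).
  2: exact: strand_refl.
have jn := leq_ltn_trans jm mn.
have [i [iS <- <-]] := column_index jn mn am nm.
by apply: rst_step; apply: piece_vertical.
Qed.

Lemma strand_new k : k < n ->
  Mid (mid (x k) k.*2) ~~> Mid (mid (b k).+1 k.*2.+1).
Proof.
move=> kn; apply: (@strand_trans (Mid (mid (b k) k.*2))); last first.
  apply: (@strand_root_upper (b k).+1) => //.
  by rewrite ltnSn ltnS bk // ltnW.
have [d ed] : exists d, b k = x k + d by exists (b k - x k); have := xb k; lia.
rewrite ed; have : x k + d <= b k by rewrite ed.
elim: d {ed} => [|d IH] db; first by rewrite addn0; apply: strand_refl.
apply: strand_trans (IH _) _; first by lia.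
by rewrite addnS; apply: (@strand_cross_new (x k + d).+1) => //; lia.
Qed.

(** The edges on the line [x + y = 2k] have this level; descending from it gives the place on the
    path of vertex [j] of the path truncated at that line. *)
Let level k := k.*2.-1.

(** The three cases of [gather]: a vertical descent to the left of [x k], one crossing tile between
    the new ends, two root tiles beyond the new right-hand end. *)
Lemma strand_level k j : k < n -> j < k.+1.*2 -> j != x k -> j != (b k).+1 ->
  Mid (mid j (descend x j (level k.+1))) ~~>
  Mid (mid (gather (x k) (b k) j) (descend x (gather (x k) (b k) j) (level k))).
Proof.
move=> kn jk jx jb; rewrite /level doubleS /=.
have bkn := bk (ltnW kn); have xbk := xb k.
case: (ltngtP j (x k)) jx => // [jx|xj] _.
  have -> : gather (x k) (b k) j = j by rewrite /gather; lia.
  rewrite above_odd (ltnW jx); case: k kn jx {bkn xbk jk jb} => [|k] kn jx.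
    by rewrite x0 in jx.
  rewrite doubleS descend_above; first exact: strand_refl.
  by rewrite -doubleS above_even.
rewrite above_odd leqNgt xj /=.
case: (ltngtP j (b k).+1) jb => // [jb|bj] _.
  have -> : gather (x k) (b k) j = j.-1 by rewrite /gather; lia.
  have xjb : x k < j <= b k by lia.
  apply: strand_trans (strand_cross_old kn xjb) _.
  apply: strand_descend; [lia|lia|].
  have k0 : 0 < k.*2 by lia.
  by rewrite prednK // above_even -leqNgt; lia.
have -> : gather (x k) (b k) j = j.-2 by rewrite /gather; lia.
apply: strand_trans (strand_sym (strand_root_upper kn _)) _; first by lia.
apply: strand_trans (strand_sym (strand_root_lower kn _)) _; first by lia.
apply: strand_descend; [lia|lia|].
have k0 : 0 < k.*2 by lia.
by rewrite prednK // above_even -leqNgt; lia.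
Qed.

Lemma strand_new_level k : k < n ->
  Mid (mid (x k) (descend x (x k) (level k.+1))) ~~>
  Mid (mid (b k).+1 (descend x (b k).+1 (level k.+1))).
Proof.
move=> kn; rewrite /level doubleS [k.*2.+2.-1]/=.
rewrite descend_above ?above_odd // !descend_id; first exact: strand_new.
  by rewrite above_odd -ltnNge ltnS xb.
by rewrite above_even ltnn.
Qed.

Lemma label_strand_level k j l : k <= n -> j < k.*2 -> l < k.*2 ->
  label x b k j = label x b k l ->
  Mid (mid j (descend x j (level k))) ~~> Mid (mid l (descend x l (level k))).
Proof.
elim: k j l => // k IH j l kn jk lk.
have new j' l' : (j' == x k) || (j' == (b k).+1) ->
    (l' == x k) || (l' == (b k).+1) ->
    Mid (mid j' (descend x j' (level k.+1))) ~~>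
    Mid (mid l' (descend x l' (level k.+1))).
  have h := strand_new_level kn.
  case/orP=> /eqP-> /orP[] /eqP-> //; try exact: strand_refl.
  exact: strand_sym.
have old j' : j' < k.+1.*2 -> j' != x k -> j' != (b k).+1 ->
    label x b k.+1 j' < k.
  move=> jk' jx jb; rewrite label_old //; apply: label_lt.
  (* [label_lt] needs an earlier arc. For [k = 0] the only vertices are 0 and 1, both ends of the
     new arc. *)
  case: k {IH jk lk new} kn jk' jx jb => // kn.
  have := @bk 0 (leq0n _); rewrite x0; case: j' => [|[|j']] //= ? _.
  by move=> /eqP h; lia.
have isnew j' : (j' == x k) || (j' == (b k).+1) -> label x b k.+1 j' = k.
  exact: label_new.
have [nj|] := boolP ((j == x k) || (j == (b k).+1)).
  have [nl|] := boolP ((l == x k) || (l == (b k).+1)).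
    by move=> _; apply: new.
  by rewrite negb_or isnew // => /andP[lx lb] e; have := old l lk lx lb; lia.
rewrite negb_or => /andP[jx jb].
have [nl|] := boolP ((l == x k) || (l == (b k).+1)).
  by rewrite [RHS]isnew // => e; have := old j jk jx jb; lia.
rewrite negb_or => /andP[lx lb]; rewrite !label_old // => e.
have bound i : i < k.+1.*2 -> i != x k -> i != (b k).+1 ->
    gather (x k) (b k) i < k.*2.
  by rewrite /gather => ik ix ib; have := xb k; have := bk (ltnW kn); lia.
apply: strand_trans (strand_level kn jk jx jb) _.
apply: strand_trans (strand_sym (strand_level kn lk lx lb)).
by apply: IH => //; [exact: ltnW | exact: bound | exact: bound].
Qed.

Lemma strand_boundary j l : j < n.*2 -> l < n.*2 ->
  strand n p (Boundary j) (Boundary l) <-> label x b n j = label x b n l.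
Proof.
move=> jn ln; split=> [/strand_label //|e].
have top i : i < n.*2 -> Boundary i ~~> Mid (mid i (descend x i (level n))).
  move=> iN; have [sz ei] := column_pos iN.
  rewrite /level -descend_above prednK ?above_last //; try lia.
  by rewrite -ei; apply: rst_step; apply: piece_top.
apply: strand_trans (top j jn) _; apply: strand_trans (strand_sym (top l ln)).
exact: label_strand_level.
Qed.

End Strands.

(** * Brauer diagrams as lists of arcs *)

Lemma label_matching x b k : admissible x b k ->
  forall j l, j < l -> l < k.*2 ->
  ((j, l) \in matching x b k) = (label x b k j == label x b k l).
Proof.
elim: k => // k IH adm j l jl lk; have [xb bk _] := adm k (ltnSn k).
have adm' := admissibleW (leqnSn k) adm.
rewrite [matching _ _ _]/= mem_rcons inE xpair_eqE.
have old (a c : nat) :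
    (a == x k) || (a == (b k).+1) || (c == x k) || (c == (b k).+1) ->
    (a, c) \in [seq spread_arc (x k) (b k) d | d <- matching x b k] = false.
  move=> h; apply/negP=> /mapP[d _ [ea ec]]; move: h.
  by rewrite ea ec /spread; lia.
have lt i : i < k.+1.*2 -> i != x k -> i != (b k).+1 -> label x b k.+1 i < k.
  move=> ik ix ib; rewrite label_old //; apply: label_lt.
  by move: ik ix ib; case: (k) bk xb => // b0 x0; lia.
have [sj|] := boolP ((j == x k) || (j == (b k).+1)).
  rewrite old ?sj // orbF label_new //.
  have [sl|] := boolP ((l == x k) || (l == (b k).+1)).
    by rewrite label_new // eqxx; lia.
  rewrite negb_or => /andP[lx lb].
  by have := lt l lk lx lb; move: lx lb; lia.
rewrite negb_or => /andP[jx jb]; rewrite (negPf jx) /= -/(label x b k.+1 l).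
have [sl|] := boolP ((l == x k) || (l == (b k).+1)).
  rewrite old -?orbA ?sl ?orbT // [label _ _ _ l]label_new //.
  by have := lt j (ltn_trans jl lk) jx jb; rewrite -/(label x b k.+1 j); lia.
rewrite negb_or => /andP[lx lb].
rewrite -/(label x b k.+1 j) !label_old //.
set gj := gather _ _ j; set gl := gather _ _ l.
rewrite -IH //; first 1 last.
- by rewrite /gj /gl /gather; lia.
- by rewrite /gl /gather; lia.
have <- : spread_arc (x k) (b k) (gj, gl) = (j, l).
  by rewrite /spread_arc /= !gatherK.
by rewrite mem_map //; apply: spread_arc_inj.
Qed.

Lemma eq_root_code x x' n : (forall k, k < n -> x k = x' k) ->
  forall k, k < n -> root_code x k = root_code x' k.
Proof.
by move=> h; elim=> [|k IH] kn /=; rewrite h // IH // ltnW.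
Qed.

Lemma eq_matching2 x x' b b' n : (forall k, k < n -> x k = x' k) ->
  (forall k, k < n -> b k = b' k) -> matching x b n = matching x' b' n.
Proof.
elim: n => //= n IH hx hb; rewrite hx // hb // IH // => k kn.
  by apply: hx; apply: ltnW.
by apply: hb; apply: ltnW.
Qed.

Lemma matching_fst_le x b n (c : darc) : admissible x b n.+1 ->
  c \in matching x b n.+1 -> c.1 <= b n.
Proof.
move=> adm; have [xb _ _] := adm n (ltnSn n).
rewrite [matching _ _ _]/= mem_rcons inE => /predU1P[->//|/mapP[d dM ->]].
have [_ d1 _] := arc_bounds (admissibleW (leqnSn n) adm) dM.
by rewrite /= /spread; lia.
Qed.

Lemma last_left_end n M : is_matching n.+1 M ->
  exists2 c : darc, c \in M & {in M, forall d : darc, d.1 <= c.1}.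
Proof.
move=> mM; have : 0 < size M by rewrite (matching_size mM).
elim: M {mM} => // a [|a' M] IH _.
  by exists a; rewrite ?mem_head // => d; rewrite inE => /eqP->.
have [//|c cM cmax] := IH; case: (leqP a.1 c.1) => ac.
  exists c; first by rewrite inE cM orbT.
  by move=> d; rewrite inE => /predU1P[->//|]; apply: cmax.
exists a; first exact: mem_head.
move=> d; rewrite inE => /predU1P[->//|/cmax dc].
by apply: leq_trans dc (ltnW ac).
Qed.

(* Removing the arc which ends just after the last left-hand end inverts the
   insertion of the last arc of a code. *)
Lemma matching_code n M : is_matching n M ->
  exists2 x, code n x & perm_eq M (matching x (root_code x) n).
Proof.
elim: n M => [|n IH] M mM.
  exists (fun _ => 0); last by have /size0nil-> := matching_size mM.
  by split=> // k; rewrite leqn0 => /eqP->.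
have [c cM cmax] := last_left_end mM; set m := c.1 in cmax.
have cc : m < c.2 by apply: mM.2.
have c2n : c.2 < n.+1.*2 by rewrite -(mem_ends_iota _ mM) mem_snd.
have [e eM e2] : exists2 e : darc, e \in M & e.2 = m.+1.
  have : m.+1 \in ends M by rewrite (mem_ends_iota _ mM); lia.
  rewrite mem_cat => /orP[/mapP[d /cmax dm ed]|/mapP[d dM ->]].
    2: by exists d.
  by rewrite -ed ltnn in dm.
have em : e.1 <= m by apply: cmax.
have mn : m <= n.*2 by lia.
have pM := perm_to_rem eM; set M1 := rem e M in pM.
pose s := spread e.1 m; pose g := gather e.1 m.
pose M' : seq darc := [seq (g d.1, g d.2) | d <- M1].
have uM : uniq (e.1 :: e.2 :: ends M1).
  rewrite -(perm_uniq (ends_cons e M1)) -(perm_uniq (perm_ends pM)).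
  exact: matching_uniq_ends mM.
have sg v : v \in ends M1 -> s (g v) = v.
  move=> vM; rewrite /s /g gatherK //.
    by apply: contraTneq uM => <-; rewrite /= inE vM orbT.
  by apply: contraTneq uM; rewrite -e2 => <-; rewrite /= vM andbF.
have sM' : [seq spread_arc e.1 m d | d <- M'] = M1.
  rewrite -map_comp -[RHS]map_id; apply/eq_in_map => -[d1 d2] dM1.
  by congr (_, _); apply: sg; [apply: (mem_fst dM1) | apply: (mem_snd dM1)].
have eM' : e = (e.1, m.+1) by rewrite -e2; case: (e).
have mM' : is_matching n M'.
  split; last first.
    move=> _ /mapP[d dM1 ->] /=; rewrite -(ltn_spread e.1 m) -/s.
    rewrite !sg ?mem_fst ?mem_snd //; apply: mM.2; exact: mem_rem dM1.
  have : perm_eq (e.1 :: m.+1 :: [seq s v | v <- ends M'])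
                 (e.1 :: m.+1 :: [seq s v | v <- iota 0 n.*2]).
    rewrite perm_sym; apply: perm_trans (perm_spread_iota em mn) _.
    rewrite -ends_map [X in ends X]sM' -e2 perm_sym.
    apply: perm_trans mM.1; rewrite perm_sym.
    by apply: perm_trans (perm_ends pM) (ends_cons _ _).
  by rewrite !perm_cons => /(perm_map_inj (@spread_inj _ _)).
have [x' cx' pM'] := IH M' mM'; have adm' := code_admissible cx'.
pose x k := if k < n then x' k else if k == n then e.1 else n.+1.*2.
have xx' k : k < n -> x k = x' k by rewrite /x => ->.
have bb' := eq_root_code xx'.
have xn : x n = e.1 by rewrite /x ltnn eqxx.
have cx : code n.+1 x.
  split; last by rewrite /x ltnNge leqnSn /= gtn_eqF.
  move=> k kn; rewrite /x; case: ifP => [/ltnW/cx'.1//|].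
  by case: eqP => [->|]; lia.
(* With [v] the last left-hand end of [M'], the claim is that [m] is the maximum of [e.1] and
   [v + 1]. Maximality of [m] gives one inequality. For the other, if [e.1 < m] then [c] survives
   the removal and starts at [m - 1] in [M'], so [v >= m - 1]. *)
exists x => //; have bn : root_code x n = m.
  have [n0|n0] := posnP n; first by move: xn mn; rewrite n0 /= => ->; lia.
  have -> : root_code x n = maxn e.1 (root_code x' n.-1).+1.
    by rewrite -{1}(prednK n0) /= prednK // xn bb' // prednK.
  have adm1 : admissible x' (root_code x') n.-1.+1 by rewrite prednK.
  set v := root_code x' n.-1.
  have [d dM' d1] := last_fst_matching adm1; rewrite -/v prednK // in d1 dM'.
  have dM1 : spread_arc e.1 m d \in M1 by rewrite -sM' map_f // (perm_mem pM').
  have h1 := cmax _ (mem_rem dM1); rewrite /= d1 in h1.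
  have h2 : e.1 < m -> m.-1 <= v.
    move=> em'; have cM1 : c \in M1.
      have : c \in e :: M1 by rewrite -(perm_mem pM).
      by rewrite inE => /predU1P[ce|//]; rewrite -ce ltnn in em'.
    have : (g c.1, g c.2) \in M'.
      exact: (map_f (fun d : darc => (g d.1, g d.2))).
    rewrite (perm_mem pM') -(prednK n0) => /(matching_fst_le adm1).
    rewrite /= -/v -/m /g /gather.
    by lia.
  by move: h1; rewrite /spread; lia.
rewrite /= xn bn (eq_matching2 xx' bb').
rewrite perm_sym perm_rcons perm_sym -eM'; apply: perm_trans pM _.
by rewrite perm_cons -sM' perm_map.
Qed.

Definition linked (M : seq darc) (u v : nat) : bool :=
  ((u, v) \in M) || ((v, u) \in M).

Lemma linkedC M u v : linked M u v = linked M v u.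
Proof. by rewrite /linked orbC. Qed.

Lemma linked_lt n M u v : is_matching n M -> u < v ->
  linked M u v = ((u, v) \in M).
Proof.
move=> mM uv; rewrite /linked orbC; case: (boolP ((v, u) \in M)) => // vuM.
by have := mM.2 _ vuM => /=; lia.
Qed.

Lemma linked_fun n M u v w : is_matching n M -> linked M u v -> linked M u w ->
  v = w.
Proof.
move=> mM /orP[h|h] /orP[h'|h'].
- by have [] := matching_fst_inj mM h h' erefl.
- by have := matching_fst_neq_snd mM h h'; rewrite eqxx.
- by have := matching_fst_neq_snd mM h' h; rewrite eqxx.
- by have [] := matching_snd_inj mM h h' erefl.
Qed.

Definition diagram (n : nat) (M : seq darc) : {set {set 'I_(n.*2)}} :=
  [set A : {set 'I_(n.*2)} | [exists k, exists l,
     [&& A == [set k; l], k != l & linked M k l]]].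

Lemma diagramP n M (A : {set 'I_(n.*2)}) :
  reflect (exists k l, [/\ A = [set k; l], k != l & linked M k l])
          (A \in diagram n M).
Proof.
rewrite inE; apply: (iffP existsP) => [[k /existsP[l /and3P[/eqP-> kl h]]]|].
  by exists k, l.
by move=> [k [l [-> kl h]]]; exists k; apply/existsP; exists l; rewrite eqxx kl.
Qed.

Lemma eq_diagram n M N : perm_eq M N -> diagram n M = diagram n N.
Proof.
move=> MN; apply/setP=> A; apply/diagramP/diagramP=> -[k [l [eA kl h]]];
  exists k, l; split=> //; move: h; by rewrite /linked !(perm_mem MN).
Qed.

Lemma linked_exists n M (v : 'I_(n.*2)) : is_matching n M ->
  exists2 u : 'I_(n.*2), v != u & linked M v u.
Proof.
move=> mM; have : (v : nat) \in ends M by rewrite (mem_ends_iota _ mM).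
rewrite mem_cat => /orP[] /mapP[[a c] acM /= ev]; have /= ac := mM.2 _ acM.
  have cN : c < n.*2 by rewrite -(mem_ends_iota _ mM); apply: (mem_snd acM).
  exists (Ordinal cN); last by rewrite /linked /= ev acM.
  by rewrite -val_eqE /= ev; lia.
have aN : a < n.*2 by rewrite -(mem_ends_iota _ mM); apply: (mem_fst acM).
exists (Ordinal aN); last by rewrite /linked /= ev acM orbT.
by rewrite -val_eqE /= ev; lia.
Qed.

Lemma diagram_mem n M (A : {set 'I_(n.*2)}) v : is_matching n M ->
  A \in diagram n M -> v \in A ->
  exists u, [/\ A = [set v; u], v != u & linked M v u].
Proof.
move=> mM /diagramP[k [l [-> kl h]]]; rewrite !inE => /orP[]/eqP->.
  by exists l.
by exists k; rewrite setUC eq_sym linkedC.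
Qed.

Lemma brauer_diagram n M : is_matching n M -> brauer (diagram n M).
Proof.
move=> mM; apply/andP; split; last first.
  by apply/forall_inP=> A /diagramP[k [l [-> kl _]]]; rewrite cards2 kl.
apply/and3P; split.
- rewrite eqEsubset subsetT; apply/subsetP=> v _; apply/bigcupP.
  have [u vu h] := linked_exists v mM.
  exists [set v; u]; last by rewrite set21.
  by apply/diagramP; exists v, u.
- apply/trivIsetP=> A B AD BD; apply: contraR; rewrite -setI_eq0.
  case/set0Pn=> v; rewrite inE => /andP[vA vB].
  have [u [-> _ h]] := diagram_mem mM AD vA.
  have [w [-> _ h']] := diagram_mem mM BD vB.
  by rewrite (val_inj (linked_fun mM h h')).
- by apply/negP=> /diagramP[k [l [/setP/(_ k)]]]; rewrite !inE eqxx.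
Qed.

Lemma pair_diagram n M (k l : 'I_(n.*2)) : is_matching n M -> k < l ->
  ([set k; l] \in diagram n M) = ((val k, val l) \in M).
Proof.
move=> mM kl; rewrite -(linked_lt mM kl); apply/idP/idP => [h|h].
  have [u [e ku h']] := diagram_mem mM h (set21 k l).
  have : u \in [set k; l] by rewrite e set22.
  by rewrite !inE eq_sym (negPf ku) => /eqP<-.
by apply/diagramP; exists k, l; split=> //; rewrite -val_eqE /= ltn_eqF.
Qed.

Definition pair_list n (D : {set {set 'I_(n.*2)}}) : seq darc :=
  [seq (val x.1, val x.2)
    | x <- enum [pred x : 'I_(n.*2) * 'I_(n.*2)
                | (x.1 < x.2) && ([set x.1; x.2] \in D)]].

Lemma uniq_pair_list n (D : {set {set 'I_(n.*2)}}) : uniq (pair_list D).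
Proof.
rewrite map_inj_uniq ?enum_uniq //.
by move=> [a c] [a' c'] /= [/val_inj-> /val_inj->].
Qed.

Lemma mem_pair_list n (D : {set {set 'I_(n.*2)}}) (c : darc) :
  reflect (exists k l : 'I_(n.*2), [/\ c = (val k, val l), k < l &
             [set k; l] \in D])
          (c \in pair_list D).
Proof.
apply: (iffP mapP) => [[[k l]]|[k [l [-> kl klD]]]].
  by rewrite mem_enum inE /= => /andP[kl klD] ->; exists k, l.
by exists (k, l) => //; rewrite mem_enum inE /= kl.
Qed.

Lemma arcs_diagram n M : is_matching n M -> arcs (diagram n M) = right_std M.
Proof.
move=> mM; have pL : perm_eq (pair_list (diagram n M)) M.
  apply: uniq_perm; rewrite ?uniq_pair_list ?(is_matching_uniq mM) // => c.
  apply/mem_pair_list/idP => [[k [l [-> kl]]]|cM].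
    by rewrite pair_diagram.
  have c1 : c.1 < n.*2 by rewrite -(mem_ends_iota _ mM) mem_fst.
  have c2 : c.2 < n.*2 by rewrite -(mem_ends_iota _ mM) mem_snd.
  exists (Ordinal c1), (Ordinal c2); have cc := mM.2 _ cM.
  by rewrite pair_diagram //=; split=> //; case: (c) cM.
apply: (@right_std_eq n).
- by apply: is_matching_perm mM; rewrite perm_sym.
- by apply: perm_trans pL _; rewrite perm_sym perm_right_std.
- exact: right_std_sorted.
Qed.

Lemma brauer_block n (D : {set {set 'I_(n.*2)}}) A B v : brauer D ->
  A \in D -> B \in D -> v \in A -> v \in B -> A = B.
Proof.
case/andP=> /and3P[_ /trivIsetP tD _] _ AD BD vA vB; apply/eqP.
have := contraNT (tD A B AD BD); apply.
by rewrite -setI_eq0; apply/set0Pn; exists v; rewrite inE vA.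
Qed.

Lemma brauer_matching n (D : {set {set 'I_(n.*2)}}) : brauer D ->
  is_matching n (pair_list D).
Proof.
move=> bD; split; last by move=> _ /mem_pair_list[k [l [-> kl _]]].
have same (k l k' l' : 'I_(n.*2)) : [set k; l] \in D -> [set k'; l'] \in D ->
    [|| k == k', l == l', k == l' | l == k'] -> [set k; l] = [set k'; l'].
  move=> D1 D2 /or4P[]/eqP e; apply: (brauer_block bD D1 D2).
  - exact: set21.
  - by rewrite e set21.
  - exact: set22.
  - by rewrite e set22.
  - exact: set21.
  - by rewrite e set22.
  - exact: set22.
  - by rewrite e set21.
have eqs (k l k' l' : 'I_(n.*2)) : k < l -> k' < l' ->
    [set k; l] = [set k'; l'] -> k = k' /\ l = l'.
  move=> kl kl' /setP e; move: (e k) (e l); rewrite !inE !eqxx orbT /=.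
  move=> /esym/orP[] /eqP ek /esym/orP[] /eqP el; split=> //; subst; lia.
apply: uniq_perm; rewrite ?iota_uniq //.
  rewrite cat_uniq; apply/and3P; split.
  - rewrite map_inj_in_uniq ?uniq_pair_list //.
    move=> _ _ /mem_pair_list[k [l [-> kl D1]]]
      /mem_pair_list[k' [l' [-> kl' D2]]] /= /val_inj e.
    subst k'; have := same _ _ _ _ D1 D2; rewrite eqxx => /(_ isT).
    by case/(eqs _ _ _ _ kl kl') => _ ->.
  - apply/hasPn=> _ /mapP[_ /mem_pair_list[k [l [-> kl D1]]] ->].
    apply/mapP=> -[_ /mem_pair_list[k' [l' [-> kl' D2]]] /= /val_inj e].
    subst k'; have := same _ _ _ _ D1 D2; rewrite eqxx !orbT => /(_ isT).
    by case/(eqs _ _ _ _ kl kl') => _ el; rewrite -el ltnn in kl'.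
  - rewrite map_inj_in_uniq ?uniq_pair_list //.
    move=> _ _ /mem_pair_list[k [l [-> kl D1]]]
      /mem_pair_list[k' [l' [-> kl' D2]]] /= /val_inj e.
    subst l'; have := same _ _ _ _ D1 D2; rewrite eqxx !orbT => /(_ isT).
    by case/(eqs _ _ _ _ kl kl') => ->.
move=> v; rewrite mem_iota /= add0n; apply/idP/idP => [|vn].
  by rewrite mem_cat => /orP[] /mapP[_ /mem_pair_list[k [l [-> _ _]]] ->] /=.
case/andP: (bD) => /and3P[/eqP cov _ _] /forall_inP card2.
have : Ordinal vn \in cover D by rewrite cov inE.
case/bigcupP=> A AD vA; have /cards2P[k [l [kl eA]]] := card2 A AD.
wlog klt : k l kl eA / k < l => [hw|].
  case: (ltngtP k l) => [kl'|lk|/val_inj e]; first exact: (hw k l).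
    by apply: (hw l k) => //; rewrite ?[l == k]eq_sym // setUC.
  by rewrite e eqxx in kl.
have cM : (val k, val l) \in pair_list D.
  by apply/mem_pair_list; exists k, l; rewrite -eA.
have : Ordinal vn \in [set k; l] by rewrite -eA.
rewrite !inE => /orP[] /eqP /(congr1 val) /= ->.
  exact: (mem_fst cM).
exact: (mem_snd cM).
Qed.

Lemma diagram_pair_list n (D : {set {set 'I_(n.*2)}}) : brauer D ->
  diagram n (pair_list D) = D.
Proof.
move=> bD; have mM := brauer_matching bD; apply/setP=> A.
apply/diagramP/idP => [[k [l [-> kl]]]|AD].
  case/orP=> /mem_pair_list[k' [l' [[/val_inj-> /val_inj->] _]]] //.
  by rewrite setUC.
case/andP: (bD) => _ /forall_inP/(_ A AD)/cards2P[k [l [kl eA]]].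
exists k, l; split=> //; case: (ltngtP k l) => [kl'|lk|/val_inj e].
- by apply/orP; left; apply/mem_pair_list; exists k, l; rewrite -eA.
- by apply/orP; right; apply/mem_pair_list; exists l, k; rewrite setUC -eA.
- by rewrite e eqxx in kl.
Qed.

Lemma Psi_opath n x : code n x ->
  Psi n (opath x n) = diagram n (matching x (root_code x) n).
Proof.
move=> cx; have adm := code_admissible cx; have mM := matchingP adm.
apply/setP=> A; rewrite !inE; apply: eq_existsb => k; apply: eq_existsb => l.
congr (_ && _); case: eqVneq => //= kl.
have strandE : `[< strand n (opath x n) (Boundary k) (Boundary l) >] =
    (label x (root_code x) n k == label x (root_code x) n l).
  have h := strand_boundary cx (ltn_ord k) (ltn_ord l).
  by apply/asboolP/eqP => /h.
rewrite strandE; case: (ltngtP k l) => [lt|lt|/val_inj e].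
- by rewrite (linked_lt mM lt) label_matching.
- by rewrite linkedC (linked_lt mM lt) label_matching // eq_sym.
- by rewrite e eqxx in kl.
Qed.

Lemma Phi_diagram n x : code n x ->
  Phi (diagram n (matching x (root_code x) n)) = opath x n.
Proof.
move=> cx; rewrite /Phi arcs_diagram ?Phi_arcs_matching //.
exact: (matchingP (code_admissible cx)).
Qed.

Lemma brauer_code n (D : {set {set 'I_(n.*2)}}) : brauer D ->
  exists2 x, code n x & D = diagram n (matching x (root_code x) n).
Proof.
move=> bD; have [x cx pM] := matching_code (brauer_matching bD).
by exists x => //; rewrite -(eq_diagram _ pM) diagram_pair_list.
Qed.

(** Every diagram and every path comes from a code, and on a code both maps are explicit, by
    [Phi_diagram] and [Psi_opath]. *)
Theorem theorem9p10 (n : nat) (hn : (0 < n)%N) :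
  [/\ forall D : {set {set 'I_(n.*2)}}, brauer D -> overhang n (Phi D),
      forall p : seq step, overhang n p -> brauer (Psi n p),
      forall D : {set {set 'I_(n.*2)}}, brauer D -> Psi n (Phi D) = D
    & forall p : seq step, overhang n p -> Phi (Psi n p) = p].
Proof.
split.
- by move=> D /brauer_code[x cx ->]; rewrite Phi_diagram // overhang_opath.
- move=> p /overhang_code[x cx ->]; rewrite Psi_opath //.
  exact/brauer_diagram/matchingP/code_admissible.
- by move=> D /brauer_code[x cx ->]; rewrite Phi_diagram // Psi_opath.
- by move=> p /overhang_code[x cx ->]; rewrite Psi_opath // Phi_diagram.
Qed.
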